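(* Let $A=(a_{ij})_{n\times n}$ be a $0$-$1$-matrix and let $\underline{T}=(T_1,\dots,T_n)$ be a contractive $n$-tuple of bounded operators on a Hilbert space $\mathcal{H}$ satisfying $A$-relations. Then there exists a minimal Cuntz-Krieger dilation $\tilde{\underline{T}}=(\tilde T_1,\dots,\tilde T_n)$ of $\underline{T}$ on a Hilbert space $\tilde{\mathcal{H}}\supseteq\mathcal{H}$, and it is unique up to unitary equivalence. Moreover $\tilde{\underline{T}}$ is unital if and only if $\underline{T}$ is unital.
   Context: All Hilbert spaces are complex and separable. $A=(a_{ij})_{n\times n}$ has entries $a_{ij}\in\{0,1\}$ and each row and each column has at least one non-zero entry. An $n$-tuple $\underline{T}$ of bounded operators is contractive if $\sum_i T_iT_i^*\le I$, and unital if $\sum_i T_iT_i^*=I$. It satisfies $A$-relations if $T_iT_j=a_{ij}T_iT_j$ for all $1\le i,j\le n$. Words: $\Lambda=\{1,\dots,n\}$, $\tilde\Lambda=\bigcup_{m\ge0}\Lambda^m$ (with $\Lambda^0=\{0\}$ the empty word); for $\alpha=\alpha_1\cdots\alpha_m$, $\underline{T}^\alpha=T_{\alpha_1}\cdots T_{\alpha_m}$, and $\underline{T}^0=I$. If $\mathcal{H}$ is a closed subspace of $\mathcal{L}$ and $\underline{T},\underline{R}$ are $n$-tuples on $\mathcal{H},\mathcal{L}$ respectively, $\underline{R}$ is a dilation of $\underline{T}$ if $R_i^*h=T_i^*h$ for all $h\in\mathcal{H}$, $1\le i\le n$. It is minimal if $\overline{\mathrm{span}}\{\underline{R}^\alpha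 h:\alpha\in\tilde\Lambda,h\in\mathcal{H}\}=\mathcal{L}$. If $\underline{T}$ satisfies $A$-relations, a dilation $\underline{R}$ of $\underline{T}$ is a Cuntz-Krieger dilation if the $R_i$ are partial isometries with mutually orthogonal ranges, $\underline{R}$ satisfies $A$-relations, and $R_i^*R_i=I-\sum_{j=1}^n(1-a_{ij})R_jR_j^*$ for all $i$. Unitary equivalence of two dilations of $\underline{T}$ means a unitary between the dilation spaces that fixes $\mathcal{H}$ pointwise and intertwines the two tuples. *)

(* Defs.v *)
From HB Require Import structures.
From mathcomp Require Import all_boot all_order all_algebra.
From mathcomp Require Import complex.
From mathcomp Require Import boolp classical_sets cardinality reals topology.
From mathcomp Require Import normedtype.

Set Implicit Arguments.
Unset Strict Implicit.
Unset Printing Implicit Defensive.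

Import Order.TTheory GRing.Theory Num.Theory.

Local Open Scope classical_set_scope.
Local Open Scope ring_scope.

(* The inner product is linear in its first argument
   and conjugate-linear in its second; the ordering of R[i] is the partial one
   ([z <= w] iff [w - z] is a nonnegative real). *)
HB.mixin Record CompleteNormedModule_isHilbert (R : realType) V
    & CompleteNormedModule R[i] V := {
  hdot : {dot V for (@Num.conj R[i])} ;
  normr_hdot : forall x : V, `|x| ^+ 2 = hdot x x
}.

#[short(type="hilbertType")]
HB.structure Definition Hilbert (R : realType) :=
  {V of CompleteNormedModule R[i] V & CompleteNormedModule_isHilbert R V}.

Notation "''[' x , y ]" := (hdot x y) : ring_scope.

Definition separable (X : topologicalType) :=
  exists2 D : set X, countable D & dense D.

Section Operators.
Variable R : realType.
Implicit Types H K : hilbertType R.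

Definition bounded_op H K (f : H -> K) :=
  exists M : R[i], forall x, `|f x| <= M * `|x|.

(* For a bounded linear [f] the Riesz representation theorem provides, for each
   [y], exactly one [z] in the set below; elsewhere the value 0 is junk. *)
Definition adjoint H K (f : H -> K) (y : K) : H :=
  xget 0 [set z | forall x, '[f x, y] = '[x, z]].

Definition op_le H (f g : H -> H) := forall x, 0 <= '[g x - f x, x].

Definition partial_isometry H K (f : H -> K) :=
  forall x, (forall y, f y = 0 -> '[x, y] = 0) -> `|f x| = `|x|.

Definition lin_span H (E : set H) : set H :=
  [set x | exists (m : nat) (c : 'I_m -> R[i]) (v : 'I_m -> H),
     (forall k, E (v k)) /\ x = \sum_(k < m) c k *: v k].

End Operators.

Section Tuples.
Variables (R : realType) (n : nat).
Implicit Types H K : hilbertType R.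

Definition row_sum H (T : 'I_n -> H -> H) (x : H) : H :=
  \sum_(i < n) T i (adjoint (T i) x).

Definition contractive H (T : 'I_n -> H -> H) := op_le (row_sum T) id.

Definition unital H (T : 'I_n -> H -> H) := row_sum T =1 id.

Definition A_relations (A : 'M[bool]_n) H (T : 'I_n -> H -> H) :=
  forall i j x, T i (T j x) = (A i j)%:R *: T i (T j x).

(* [word T [:: a1; ...; am]] is [T a1 \o ... \o T am]. *)
Definition word H (T : 'I_n -> H -> H) (a : seq 'I_n) : H -> H :=
  foldr (fun i f => T i \o f) id a.

(* The inclusion of H as a closed subspace of K is encoded by a linear isometry
   [J]; its range is closed because H is complete. *)
Definition dilation H K (J : {linear H -> K})
    (T : 'I_n -> {linear H -> H}) (S : 'I_n -> {linear K -> K}) :=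
  [/\ forall x y, '[J x, J y] = '[x, y],
      forall i, bounded_op (S i) &
      forall i h, adjoint (S i) (J h) = J (adjoint (T i) h)].

Definition minimal H K (J : H -> K) (S : 'I_n -> K -> K) :=
  closure (lin_span [set x | exists a h, x = word S a (J h)]) = setT.

Definition cuntz_krieger (A : 'M[bool]_n) K (S : 'I_n -> K -> K) :=
  [/\ forall i, partial_isometry (S i),
      forall i j, i != j -> forall x y, '[S i x, S j y] = 0,
      A_relations A S &
      forall i x, adjoint (S i) (S i x) =
        x - \sum_(j < n) (1 - (A i j)%:R) *: S j (adjoint (S j) x)].

Definition minimal_CK_dilation (A : 'M[bool]_n) H K (J : {linear H -> K})
    (T : 'I_n -> {linear H -> H}) (S : 'I_n -> {linear K -> K}) :=
  [/\ dilation J T S, minimal J S & cuntz_krieger A S].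

Definition dilation_equiv H K1 K2
    (J1 : {linear H -> K1}) (S1 : 'I_n -> {linear K1 -> K1})
    (J2 : {linear H -> K2}) (S2 : 'I_n -> {linear K2 -> K2}) :=
  exists U : {linear K1 -> K2},
    [/\ bijective U,
        forall x y, '[U x, U y] = '[x, y],
        forall h, U (J1 h) = J2 h &
        forall i x, U (S1 i x) = S2 i (U x)].

End Tuples.

(* Main.v *)
Require Import Defs.
From HB Require Import structures.
From mathcomp Require Import all_boot all_order all_algebra.
From mathcomp Require Import complex.
From mathcomp Require Import boolp classical_sets functions cardinality reals topology.
From mathcomp Require Import normedtype ring.

Set Implicit Arguments.
Unset Strict Implicit.
Unset Printing Implicit Defensive.

Import Order.TTheory GRing.Theory Num.Theory.
Import numFieldNormedType.Exports.

Local Open Scope classical_set_scope.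
Local Open Scope complex_scope.
Local Open Scope ring_scope.

(** A minimal Cuntz-Krieger dilation is forced by its relations.  Let [S] on [K]
    dilate [T], and let [P] be the projection [1 - \sum_j S_j S_j^*].  For every
    [x] and [m] the norm of [x] splits as
    [\sum_(|s| < m) |P S_s^* x|^2 + \sum_(|s| = m) |S_s^* x|^2], where [S_s] is the
    product along the word [s].  On the embedded copy of [H] the adjoints of the
    [S_j] act as the adjoints [Q_j] of the [T_j], and
    [|P h|^2 = |h|^2 - \sum_j |Q_j h|^2].  So a vector in the span of the [S_s h] is
    recorded by a family [s |-> x(s)] in [H]: [x(s)] represents [P S_s^* x], it
    vanishes off the admissible words, and for long words [S_s^* x] lies in [H],
    which reads [x(s j) = Q_j x(s)].

    Existence turns this into a construction.  [word_space] is the space of such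
    families, and [level_form m] is the sum above read as an inner product.  It
    is positive exactly because [T] is contractive, and it does not depend on [m]
    once [m] is large ([level_form_stable]).  On families, [S_i] prefixes the
    letter [i] and kills inadmissible words ([create]), its adjoint reads off what
    follows an initial [i] ([annihilate]), and [h] becomes [s |-> Q_s h]
    ([trajectory]); the relations are checked word by word.

    The Hilbert space is then the completion of [word_space].  It is realised as
    a space of conjugate-linear functionals: those approximable, in dual norm, by
    the functionals [b v] of vectors [v].  A contraction that has a contractive adjoint
    acts on functionals by precomposition with that adjoint, so an identity between
    operators on [word_space] holds on the completion without any density
    argument.

    Uniqueness: the relations determine every inner product
    [<S_s h, S_t k>], by stripping the first letters of [s] and [t]
    ([dilation_unique]), and two total families with the same Gram matrix are
    matched by a unitary ([unitary_of_gram]).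

    Unitality: [row_sum S] is a projection that fixes the range of every [S_i]
    and compresses to [row_sum T] on [H].  If it is the identity, so is its
    compression.  If its compression is the identity, it fixes [H], hence all
    [S_s h], hence everything by minimality.

    Adjoints of bounded operators come from the Riesz representation theorem
    ([riesz]), obtained by minimising the energy [|x|^2 - 2 Re g(x)]. *)

(** * Semi-inner products *)

(** Positive semidefinite only: distinct vectors of [word_space] may be at distance
    zero, and the completion below identifies them. *)
Record semi_inner (R : realType) (V : lmodType R[i]) := SemiInner {
  sform :> V -> V -> R[i];
  sformP : forall a x y z, sform (a *: x + y) z = a * sform x z + sform y z;
  sformC : forall x y, sform x y = (sform y x)^*;
  sform_ge0 : forall x, 0 <= sform x x }.

Section SemiInnerTheory.
Variables (R : realType) (V : lmodType R[i]) (b : semi_inner V).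
Implicit Types (x y z : V) (a : R[i]).

Lemma sformDl x y z : b (x + y) z = b x z + b y z.
Proof. by rewrite -[x in LHS]scale1r sformP mul1r. Qed.

Lemma sform0l z : b 0 z = 0.
Proof. by apply: (addrI (b 0 z)); rewrite -sformDl !addr0. Qed.

Lemma sformZl a x z : b (a *: x) z = a * b x z.
Proof. by rewrite -[a *: x]addr0 sformP sform0l addr0. Qed.

Lemma sformNl x z : b (- x) z = - b x z.
Proof. by rewrite -scaleN1r sformZl mulN1r. Qed.

Lemma sformBl x y z : b (x - y) z = b x z - b y z.
Proof. by rewrite sformDl sformNl. Qed.

Lemma sform_suml I r (P : pred I) (F : I -> V) z :
  b (\sum_(i <- r | P i) F i) z = \sum_(i <- r | P i) b (F i) z.
Proof. exact: (big_morph (b^~ z) (fun x y => sformDl x y z) (sform0l z)). Qed.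

Lemma sformDr x y z : b x (y + z) = b x y + b x z.
Proof. by rewrite sformC sformDl rmorphD/= -!sformC. Qed.

Lemma sform0r x : b x 0 = 0.
Proof. by rewrite sformC sform0l rmorph0. Qed.

Lemma sformZr a x y : b x (a *: y) = a^* * b x y.
Proof. by rewrite sformC sformZl rmorphM/= -sformC. Qed.

Lemma sformNr x y : b x (- y) = - b x y.
Proof. by rewrite sformC sformNl rmorphN/= -sformC. Qed.

Lemma sformBr x y z : b x (y - z) = b x y - b x z.
Proof. by rewrite sformDr sformNr. Qed.

Lemma sform_sumr I r (P : pred I) (F : I -> V) x :
  b x (\sum_(i <- r | P i) F i) = \sum_(i <- r | P i) b x (F i).
Proof. exact: (big_morph (b x) (fun y z => sformDr x y z) (sform0r x)). Qed.

(** Positivity of [b] at [x - t (b x y) y] gives a quadratic inequality in the real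
    number [t].  It is used at [t = 1 / b y y]; when [b y y = 0] it is affine in [t]
    and a large [t] contradicts it unless [b x y = 0]. *)
Lemma sform_cauchy_schwarz x y : `|b x y| ^+ 2 <= b x x * b y y.
Proof.
pose s := b x y; pose c := b y y.
have key (t : R[i]) : t \is Num.real ->
    t * `|s| ^+ 2 *+ 2 <= b x x + t ^+ 2 * `|s| ^+ 2 * c.
  move=> tR; have tJ : t^* = t by apply/CrealP.
  have := sform_ge0 b (x - (t * s) *: y).
  rewrite sformBl !sformBr !sformZl !sformZr rmorphM/= tJ -/s -/c.
  rewrite (sformC b y x) -/s => h; rewrite -subr_ge0; apply: le_trans h _.
  by rewrite le_eqVlt; apply/orP; left; apply/eqP; rewrite normCK; ring.
have [c0|c0] := eqVneq c 0.
  rewrite -/c c0 mulr0; case: (eqVneq s 0) => [|s0].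
    by rewrite -/s => ->; rewrite normr0 expr0n.
  have s2 : 0 < `|s| ^+ 2 by rewrite exprn_gt0 ?normr_gt0.
  have := key ((b x x + 1) / `|s| ^+ 2).
  rewrite c0 mulr0 addr0 divfK ?gt_eqF//.
  have bx := sform_ge0 b x.
  have bx1 : 0 < b x x + 1 by rewrite ltr_wpDl.
  move=> /(_ (ger0_real (divr_ge0 (ltW bx1) (ltW s2)))) h; exfalso.
  have : b x x < (b x x + 1) *+ 2 by rewrite mulr2n -addrA ltrDl addr_gt0.
  by rewrite (le_gtF h).
have cgt : 0 < c by rewrite lt_def c0 sform_ge0.
have := key c^-1; rewrite realV gtr0_real// => /(_ isT).
have -> : c^-1 ^+ 2 * `|s| ^+ 2 * c = c^-1 * `|s| ^+ 2 by field.
rewrite mulr2n lerD2r.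
by rewrite ler_pdivrMl// mulrC.
Qed.

Definition snorm x : R[i] := sqrtC (b x x).

Lemma snorm_ge0 x : 0 <= snorm x.
Proof. by rewrite sqrtC_ge0 sform_ge0. Qed.

Lemma snorm_sqr x : snorm x ^+ 2 = b x x.
Proof. exact: sqrtCK. Qed.

Lemma sform_le_snorm x y : `|b x y| <= snorm x * snorm y.
Proof.
rewrite -(@ler_pXn2r _ 2) ?nnegrE ?mulr_ge0 ?snorm_ge0//.
by rewrite exprMn !snorm_sqr sform_cauchy_schwarz.
Qed.

Lemma snormZ a x : snorm (a *: x) = `|a| * snorm x.
Proof.
rewrite /snorm sformZl sformZr mulrA -normCK sqrtCM ?nnegrE ?exprn_ge0 ?sform_ge0//.
by rewrite sqrCK.
Qed.

Lemma snormD x y : snorm (x + y) <= snorm x + snorm y.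
Proof.
rewrite -(@ler_pXn2r _ 2) ?nnegrE ?addr_ge0 ?snorm_ge0//.
rewrite sqrrD !snorm_sqr sformDl !sformDr (sformC b y x).
have -> : b x x + b x y + ((b x y)^* + b y y) =
    b x x + (b x y + (b x y)^*) + b y y by ring.
rewrite lerD2r lerD2l.
apply: (@le_trans _ _ (`|b x y| *+ 2)); last by rewrite lerMn2r sform_le_snorm.
have h : b x y + (b x y)^* \is Num.real.
  by apply/CrealP; rewrite rmorphD/= conjCK addrC.
apply: (le_trans (real_ler_norm h)); apply: le_trans (ler_normD _ _) _.
by rewrite norm_conjC mulr2n.
Qed.

End SemiInnerTheory.

(** * Limits and estimates over the complex numbers *)

(** The real and imaginary parts are 1-Lipschitz, so both converge along a Cauchy
    filter by completeness of the reals. *)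
Lemma complex_complete (R : realType) (F : set_system R[i]^o) :
  ProperFilter F -> cauchy F -> cvg F.
Proof.
move=> FF /cauchyP Fc.
have ni : `|'i%C : R[i]| = 1 by rewrite complexiE normCi.
have sub (f : R[i]^o -> R) : (forall x y, `|(f x - f y)|%:C <= `|x - y|) ->
    cvg (f @ F).
  move=> fl; apply: R_complete; apply/cauchyP => e e0.
  have e0' : 0 < e%:C by rewrite ltcR.
  have [z Fz] := Fc _ e0'; exists (f z).
  rewrite nbhs_filterE -/(f @^-1` _); apply: (@filterS _ F _ (ball z e%:C)) Fz => x h.
  by rewrite /ball /= -ltcR; exact: (le_lt_trans (fl z x) h).
have /cvg_ex[lr Hr] : cvg (@complex.Re R @ F).
  by apply: sub => x y; rewrite -raddfB; exact: normc_ge_Re.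
have /cvg_ex[li Hi] : cvg (@complex.Im R @ F).
  apply: sub => x y; rewrite -raddfB/= -normrN -ReiNIm.
  by apply: le_trans (normc_ge_Re _) _; rewrite normrM ni mulr1.
apply/cvg_ex; exists (lr +i* li)%C; apply/cvgrPdist_lt => e e0.
have eE : e = (complex.Re e)%:C by rewrite RRe_real// gtr0_real.
have e2 : 0 < complex.Re e / 2 by rewrite divr_gt0// -ltcR -eE.
have /cvgrPdist_lt/(_ _ e2) h1 := Hr.
have /cvgrPdist_lt/(_ _ e2) h2 := Hi.
near=> x.
have -> : (lr +i* li)%C - x = (lr - complex.Re x)%:C + 'i%C * (li - complex.Im x)%:C.
  by rewrite [LHS]complexE !raddfB/=.
apply: le_lt_trans (ler_normD _ _) _.
rewrite normrM ni mul1r eE.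
have nr (t : R) : `|t%:C| = `|t|%:C by rewrite normc_def/= expr0n/= addr0 sqrtr_sqr.
rewrite !nr -raddfD/= ltcR [complex.Re e]splitr ltrD//; by near: x.
Unshelve. all: by end_near. Qed.

(** Letting [e] tend to 0.  The order of a [numFieldType] is partial, but the
    hypothesis at [e = 1] already makes [x] and [y] comparable. *)
Lemma ler_eps (C : numFieldType) (x y k : C) : 0 <= k ->
  (forall e, 0 < e -> e <= 1 -> x <= y + e * k) -> x <= y.
Proof.
move=> k0 h.
have xyR : x - y \is Num.real.
  have := h 1 ltr01 (lexx _); rewrite -lerBlDl mul1r => /ler_real -> .
  exact: ger0_real.
rewrite -subr_le0 real_leNgt ?real0//; apply/negP => xy.
have kxy : 0 < k + (x - y) by rewrite ltr_wpDl.
(* This value of e lies in ]0, 1] and satisfies e * k < x - y. *)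
have := h ((x - y) / (k + (x - y))).
rewrite divr_gt0// ler_pdivrMr// mul1r lerDr k0 => /(_ isT isT).
rewrite -lerBlDl mulrAC ler_pdivlMr// ler_pM2l// gerDl => /le_gtF.
by rewrite xy.
Qed.

Lemma eq_eps (C : numFieldType) (x y k : C) : 0 <= k ->
  (forall e, 0 < e -> e <= 1 -> `|x - y| <= e * k) -> x = y.
Proof.
move=> k0 h; apply/eqP; rewrite -subr_eq0 -normr_le0.
by apply: (ler_eps k0) => e e0 e1; rewrite add0r h.
Qed.

Lemma decreasing_filter (C : numFieldType) (T : Type) (B : C -> set T) :
  (forall c d, c <= d -> B c `<=` B d) -> (forall e, 0 < e -> B e !=set0) ->
  ProperFilter (filter_from [set e : C | 0 < e] B).
Proof.
move=> Bmono Bne; apply: filter_from_proper => //.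
apply: filter_from_filter; first by exists 1; rewrite /= ltr01.
move=> c d /= c0 d0; have [cd|/ltW cd] := real_leP (gtr0_real c0) (gtr0_real d0).
  by exists c => // x Bx; split=> //; exact: Bmono Bx.
by exists d => // x Bx; split=> //; exact: Bmono Bx.
Qed.

(** The estimate by which an [M]-Lipschitz map sends points at distance at most
    [e / ((M + 1) * 2)] from a common centre to points less than [e] apart; adding 1
    to [M] covers [M = 0]. *)
Lemma modulus_lt (C : numFieldType) (M e : C) : 0 <= M -> 0 < e ->
  M * (e / ((M + 1) * 2) + e / ((M + 1) * 2)) < e.
Proof.
move=> M0 e0; have M1 : 0 < M + 1 by rewrite ltr_wpDl.
have -> : M * (e / ((M + 1) * 2) + e / ((M + 1) * 2)) = e * (M / (M + 1)).
  by field; rewrite ?gt_eqF.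
by rewrite gtr_pMr// ltr_pdivrMr ?mul1r ?ltrDl.
Qed.

(** * Completion of a semi-inner product space *)

Section Functionals.
Variables (R : realType) (V : lmodType R[i]) (b : semi_inner V).
Implicit Types (phi psi : V -> R[i]^o) (v w : V) (d e M : R[i]).

Definition dual_bound phi M := forall w, `|phi w : R[i]| <= M * snorm b w.

Definition approx phi v d := dual_bound (fun w => phi w - b v w) d.

Definition approximable phi := forall e, 0 < e -> exists v, approx phi v e.

(** A vector is no longer than the functional it represents: test that functional
    on the vector itself. *)
Lemma snorm_dual_bound v M : 0 <= M -> dual_bound (b v) M -> snorm b v <= M.
Proof.
rewrite /dual_bound => M0 /(_ v); rewrite ger0_norm ?sform_ge0// -snorm_sqr expr2.
have [->//|v0] := eqVneq (snorm b v) 0.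
by rewrite ler_pM2r// lt_def v0 snorm_ge0.
Qed.

Lemma dual_bound_le phi c d : c <= d -> dual_bound phi c -> dual_bound phi d.
Proof.
move=> cd h; rewrite /dual_bound => w; apply: (le_trans (h w)).
by rewrite ler_wpM2r ?snorm_ge0.
Qed.

Lemma dual_boundD phi psi c d :
  dual_bound phi c -> dual_bound psi d -> dual_bound (phi + psi) (c + d).
Proof.
rewrite /dual_bound => h1 h2 w; apply: (le_trans (ler_normD _ _)).
by rewrite mulrDl lerD.
Qed.

Lemma dual_boundZ a phi c : dual_bound phi c -> dual_bound (a *: phi) (`|a| * c).
Proof.
rewrite /dual_bound => h w; rewrite [(_ *: _) w]/GRing.scale/= /GRing.scale/=.
by rewrite normrM -mulrA ler_wpM2l.
Qed.

Lemma approx_dist phi v w c d : 0 <= c -> 0 <= d ->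
  approx phi v c -> approx phi w d -> snorm b (v - w) <= c + d.
Proof.
move=> c0 d0 h1 h2; apply: snorm_dual_bound; first exact: addr_ge0.
rewrite /dual_bound => u; rewrite sformBl mulrDl.
have -> : b v u - b w u = (phi u - b w u) - (phi u - b v u) by ring.
apply: le_trans (ler_normB _ _) _.
by rewrite [leRHS]addrC; apply: lerD; [exact: h2|exact: h1].
Qed.

Lemma approxP a phi psi v w c d : approx phi v c -> approx psi w d ->
  approx (a *: phi + psi) (a *: v + w) (`|a| * c + d).
Proof.
rewrite /approx /dual_bound => h1 h2 u; rewrite sformP.
have -> : (a *: phi + psi) u = a * (phi u : R[i]) + (psi u : R[i]) by [].
have -> : a * (phi u : R[i]) + (psi u : R[i]) - (a * b v u + b w u) =
    a * (phi u - b v u) + (psi u - b w u) by ring.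
apply: le_trans (ler_normD _ _) _; rewrite mulrDl lerD// normrM -mulrA.
by rewrite ler_wpM2l.
Qed.

(** A boolean predicate under its own name, since structure inference for the
    submodule below is keyed on the head constant. *)
Definition approx_pred : {pred (V -> R[i]^o)} := fun phi => `[< approximable phi >].

(** Approximants combine linearly by [approxP]; the tolerance granted to [phi] is
    divided by [`|a| + 1] so that [a = 0] needs no separate treatment. *)
Lemma approximable_submod : submod_closed approx_pred.
Proof.
split=> [|a phi psi].
  apply/asboolP => e e0; exists 0; rewrite /approx /dual_bound => w.
  rewrite sform0l subrr normr0.
  by rewrite mulr_ge0 ?snorm_ge0// ltW.
move=> /asboolP h1 /asboolP h2; apply/asboolP => e e0.
have a0 : 0 < `|a| + 1 by rewrite ltr_wpDl.
have [v hv] := h1 (e / (`|a| + 1) / 2) (divr_gt0 (divr_gt0 e0 a0) (ltr0n _ 2)).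
have [w hw] := h2 (e / 2) (divr_gt0 e0 (ltr0n _ 2)).
exists (a *: v + w); apply: (dual_bound_le _ (approxP a hv hw)).
rewrite [leRHS]splitr lerD2r mulrA ler_pM2r ?invr_gt0//.
by rewrite mulrA ler_pdivrMr// mulrC ler_pM2l// lerDl.
Qed.

End Functionals.

Section Completion.
Variables (R : realType) (V : lmodType R[i]) (b : semi_inner V).

HB.instance Definition _ := GRing.isSubmodClosed.Build R[i] (V -> R[i]^o)
  (approx_pred b) (approximable_submod b).

(** Functionals rather than classes of Cauchy sequences: equality is pointwise and
    the module structure is inherited from functions. *)
Definition completion := {phi : V -> R[i]^o | approx_pred b phi}.

HB.instance Definition _ := [isSub for (@sval _ _ : completion -> _)].
HB.instance Definition _ := [Choice of completion by <:].
HB.instance Definition _ := [SubChoice_isSubLmodule of completion by <:].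

Definition ev (f : completion) (v : V) : R[i] := val f v.

Implicit Types (f g h : completion) (v w : V) (c d e M : R[i]).

Lemma evD f g w : ev (f + g) w = ev f w + ev g w.
Proof. by []. Qed.

Lemma evZ a f w : ev (a *: f) w = a * ev f w.
Proof. by []. Qed.

Lemma completion_approx f e : 0 < e -> exists v, approx b (ev f) v e.
Proof. by move=> e0; have /asboolP/(_ _ e0) := valP f. Qed.

Lemma completion_eq f g : ev f =1 ev g -> f = g.
Proof. by move=> fg; apply/val_inj/funext. Qed.

Lemma completion_bounded f : exists2 M, 0 <= M & dual_bound b (ev f) M.
Proof.
have [v hv] := completion_approx f ltr01.
exists (1 + snorm b v); first by rewrite addr_ge0 ?snorm_ge0.
rewrite /dual_bound => w.
rewrite -[ev f w](subrK (b v w)) mulrDl; apply: le_trans (ler_normD _ _) _.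
by rewrite lerD ?hv// sform_le_snorm.
Qed.

(** Inherited from the functionals [b v] by approximation, as [b] is
    conjugate-linear in its second argument. *)
Lemma ev_antilinear f a v w : ev f (a *: v + w) = a^* * ev f v + ev f w.
Proof.
pose k := snorm b (a *: v + w) + (`|a| * snorm b v + snorm b w).
apply: (@eq_eps _ _ _ k) => [|e e0 _].
  by rewrite !addr_ge0 ?mulr_ge0 ?snorm_ge0.
have [u hu] := completion_approx f e0.
have -> : ev f (a *: v + w) - (a^* * ev f v + ev f w) =
   (ev f (a *: v + w) - b u (a *: v + w)) - (a^* * (ev f v - b u v) + (ev f w - b u w)).
  by rewrite sformDr sformZr; ring.
apply: le_trans (ler_normB _ _) _; rewrite /k [leRHS]mulrDr lerD ?hu//.
apply: le_trans (ler_normD _ _) _; rewrite [leRHS]mulrDr lerD ?hu// normrM norm_conjC.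
by rewrite mulrCA ler_wpM2l// hu.
Qed.

Lemma evB f v w : ev f (v - w) = ev f v - ev f w.
Proof.
by rewrite -[v - w]addrC -scaleN1r ev_antilinear rmorphN1 mulN1r addrC.
Qed.

(** The inner product of [f] and [g] should be [f w] when [g] is represented by [w].
    For general [g] the value [f w] at an approximant [w] of [g] is off by at most
    the dual norm of [f] times the quality of the approximation. *)
Definition pairing_spec f g (c : R[i]) := forall M d w, 0 <= M -> 0 <= d ->
  dual_bound b (ev f) M -> approx b (ev g) w d -> `|c - ev f w| <= M * d.

(** The values of [f] at better and better approximants of [g] form a Cauchy filter,
    because [f] is bounded and the approximants are close to each other. *)
Lemma pairing_exists f g : exists c, pairing_spec f g c.
Proof.
have [M M0 fM] := completion_bounded f.
have near_diff M' v w c d : 0 <= c -> 0 <= d -> dual_bound b (ev f) M' -> 0 <= M' ->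
    approx b (ev g) v c -> approx b (ev g) w d -> `|ev f v - ev f w| <= M' * (c + d).
  move=> c0 d0 fM' M'0 hv hw; rewrite -evB; apply: le_trans (fM' _) _.
  by rewrite ler_wpM2l//; exact: (approx_dist c0 d0 hv hw).
pose F : set_system R[i]^o := filter_from [set d : R[i] | 0 < d]
  (fun d => (ev f : V -> R[i]^o) @` [set w | approx b (ev g) w d]).
have FF : ProperFilter F.
  apply: decreasing_filter => [c d cd _ [w hw <-]|d d0].
    by exists w => //; exact: (dual_bound_le cd hw).
  by have [w hw] := completion_approx g d0; exists (ev f w), w.
have : cvg F.
  apply: complex_complete; apply/cauchyP => e e0.
  have M1 : 0 < (M + 1) * 2 by rewrite mulr_gt0// ltr_wpDl.
  have d0 : 0 < e / ((M + 1) * 2) by rewrite divr_gt0.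
  have [v hv] := completion_approx g d0.
  exists (ev f v), (e / ((M + 1) * 2)) => // _ [w hw <-].
  apply: le_lt_trans (near_diff _ _ _ _ _ (ltW d0) (ltW d0) fM M0 hv hw) _.
  exact: modulus_lt.
move=> /cvg_ex[c /fcvgrPdist_lt Fc]; exists c => M' d w M'0 d0 fM' hw.
apply: (@ler_eps _ _ _ (1 + M')); first exact: addr_ge0.
move=> e e0 _; have [d' /= d'0 hd'] := Fc _ e0.
have de0 : 0 < d' + e by rewrite addr_gt0.
(* d' * e / (d' + e) is a positive number below both d' and e. *)
have d''0 : 0 < d' * e / (d' + e) by rewrite divr_gt0 ?mulr_gt0.
have d''e : d' * e / (d' + e) <= e.
  by rewrite ler_pdivrMr// mulrC ler_pM2l// lerDl ltW.
have d''d' : d' * e / (d' + e) <= d'.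
  by rewrite ler_pdivrMr// ler_pM2l// lerDr ltW.
have [v hv] := completion_approx g d''0.
have cv : `|c - ev f v| < e.
  by apply: (hd' (ev f v)); exists v => //; exact: (dual_bound_le d''d' hv).
have vw := near_diff _ _ _ _ _ (ltW d''0) d0 fM' M'0 hv hw.
rewrite -[c](subrK (ev f v)) -addrA; apply: le_trans (ler_normD _ _) _.
apply: le_trans (lerD (ltW cv) vw) _.
have -> : M' * d + e * (1 + M') = e + M' * (e + d) by ring.
by rewrite lerD2l ler_wpM2l// lerD2r.
Qed.

Definition pairing f g : R[i] := xget 0 (pairing_spec f g).

Lemma pairingP f g : pairing_spec f g (pairing f g).
Proof. exact: (xgetPex 0 (pairing_exists f g)). Qed.

Lemma approx_snorm phi v M d : 0 <= M -> 0 <= d ->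
  dual_bound b phi M -> approx b phi v d -> snorm b v <= M + d.
Proof.
move=> M0 d0 h1 h2; apply: snorm_dual_bound; first exact: addr_ge0.
rewrite /dual_bound => u; rewrite mulrDl.
have -> : b v u = (phi u : R[i]) - (phi u - b v u) by rewrite opprB addrC subrK.
by apply: le_trans (ler_normB _ _) _; apply: lerD; [exact: h1|exact: h2].
Qed.

Lemma pairing_is_linear a f g h :
  pairing (a *: f + g) h = a * pairing f h + pairing g h.
Proof.
have [M M0 fM] := completion_bounded f.
have [N N0 gN] := completion_bounded g.
have aM0 : 0 <= `|a| * M + N by rewrite addr_ge0// mulr_ge0.
apply: (@eq_eps _ _ _ ((`|a| * M + N) *+ 2)); first by rewrite mulrn_wge0.
move=> e e0 _; have [w hw] := completion_approx h e0.
have fgMN : dual_bound b (ev (a *: f + g)) (`|a| * M + N).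
  exact: (dual_boundD (dual_boundZ a fM) gN).
have h1 := pairingP aM0 (ltW e0) fgMN hw.
have h2 := pairingP M0 (ltW e0) fM hw.
have h3 := pairingP N0 (ltW e0) gN hw.
have -> : pairing (a *: f + g) h - (a * pairing f h + pairing g h) =
  (pairing (a *: f + g) h - ev (a *: f + g) w) -
    (a * (pairing f h - ev f w) + (pairing g h - ev g w)).
  by rewrite evD evZ; ring.
apply: le_trans (ler_normB _ _) _; rewrite mulrnAr [e * _]mulrC mulr2n lerD//.
apply: le_trans (ler_normD _ _) _; rewrite normrM mulrDl lerD// -mulrA.
by rewrite ler_wpM2l.
Qed.

(** Approximating both arguments at once; hermitian symmetry and positivity of the
    pairing are read off from those of [b] through this estimate. *)
Lemma pairing_near f g M N e v w : 0 <= M -> 0 <= N -> 0 < e -> e <= 1 ->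
  dual_bound b (ev f) M -> dual_bound b (ev g) N ->
  approx b (ev f) v e -> approx b (ev g) w e ->
  `|pairing f g - b v w| <= e * (M + N + 1).
Proof.
move=> M0 N0 e0 e1 fM gN hv hw.
have h1 := pairingP M0 (ltW e0) fM hw.
have h2 : snorm b w <= N + e by exact: (approx_snorm N0 (ltW e0) gN hw).
rewrite -[pairing f g](subrK (ev f w)) -addrA; apply: le_trans (ler_normD _ _) _.
have -> : e * (M + N + 1) = M * e + e * (N + 1) by ring.
apply: lerD => //; apply: le_trans (hv w) _; rewrite ler_pM2l//.
by apply: le_trans h2 _; rewrite lerD2l.
Qed.

Lemma pairingC f g : pairing f g = (pairing g f)^*.
Proof.
have [M M0 fM] := completion_bounded f.
have [N N0 gN] := completion_bounded g.
apply: (@eq_eps _ _ _ ((M + N + 1) *+ 2)).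
  by rewrite mulrn_wge0 ?addr_ge0.
move=> e e0 e1; have [v hv] := completion_approx f e0.
have [w hw] := completion_approx g e0.
have h1 := pairing_near M0 N0 e0 e1 fM gN hv hw.
have h2 := pairing_near N0 M0 e0 e1 gN fM hw hv.
have -> : pairing f g - (pairing g f)^* =
  (pairing f g - b v w) - (pairing g f - b w v)^*.
  by rewrite rmorphB/= -sformC; ring.
apply: le_trans (ler_normB _ _) _; rewrite norm_conjC mulrnAr mulr2n lerD//.
by rewrite [M + N]addrC.
Qed.

Lemma pairing_ge0 f : 0 <= pairing f f.
Proof.
have [M M0 fM] := completion_bounded f.
have pR : pairing f f \is Num.real by apply/CrealP; rewrite -pairingC.
apply: (@ler_eps _ _ _ (M + M + 1)); first by rewrite !addr_ge0.
move=> e e0 e1; have [v hv] := completion_approx f e0.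
apply: le_trans (sform_ge0 b v) _; rewrite -lerBlDl.
apply: le_trans (pairing_near M0 M0 e0 e1 fM fM hv hv).
rewrite distrC; apply: real_ler_norm; rewrite rpredB//.
by rewrite ger0_real// sform_ge0.
Qed.

Definition completion_form :=
  SemiInner pairing_is_linear pairingC pairing_ge0.

Lemma embed_subproof v : approx_pred b (b v : V -> R[i]^o).
Proof.
apply/asboolP => e e0; exists v; rewrite /approx /dual_bound => w.
by rewrite subrr normr0 mulr_ge0 ?snorm_ge0// ltW.
Qed.

Definition embed v : completion := exist _ (b v : V -> R[i]^o) (embed_subproof v).

Lemma ev_embed v w : ev (embed v) w = b v w. Proof. by []. Qed.

Lemma embed_is_linear : linear embed.
Proof.
move=> a v w; apply: completion_eq => u.
by rewrite evD evZ !ev_embed sformP.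
Qed.

HB.instance Definition _ := GRing.isLinear.Build R[i] V completion _ embed
  embed_is_linear.

(** The functional [b w] is approximated by [w] with error 0, so the error in
    [pairing_spec] vanishes: elements of the completion act by pairing. *)
Lemma pairing_embedr f w : pairing f (embed w) = ev f w.
Proof.
have [M M0 fM] := completion_bounded f.
apply/eqP; rewrite -subr_eq0 -normr_le0 -[leRHS](mulr0 M).
apply: pairingP => //; rewrite /approx /dual_bound => u.
by rewrite ev_embed subrr normr0 mul0r.
Qed.

Lemma pairing_embed v w : pairing (embed v) (embed w) = b v w.
Proof. by rewrite pairing_embedr. Qed.

Lemma ev_bound f : dual_bound b (ev f) (snorm completion_form f).
Proof.
rewrite /dual_bound => w.
rewrite -pairing_embedr (_ : snorm b w = snorm completion_form (embed w)).
  exact: sform_le_snorm.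
by rewrite /snorm /= pairing_embed.
Qed.

(** With [ev_bound], this identifies the norm of the completion with the dual norm
    of functionals. *)
Lemma completion_snorm_le f M : 0 <= M -> dual_bound b (ev f) M ->
  snorm completion_form f <= M.
Proof.
move=> M0 fM; rewrite -(@ler_pXn2r _ 2) ?nnegrE ?snorm_ge0// snorm_sqr.
apply: (@ler_eps _ _ _ (M + M)); first exact: addr_ge0.
move=> e e0 e1; have [v hv] := completion_approx f e0.
have h1 := pairingP M0 (ltW e0) fM hv.
have h2 : snorm b v <= M + e by exact: (approx_snorm M0 (ltW e0) fM hv).
rewrite -[leLHS]ger0_norm ?sform_ge0//= -[pairing f f](subrK (ev f v)).
apply: le_trans (ler_normD _ _) _.
have -> : M ^+ 2 + e * (M + M) = M * e + M * (M + e) by ring.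
by apply: lerD => //; apply: le_trans (fM v) _; rewrite ler_wpM2l.
Qed.

Lemma completion_snorm_eq0 f : snorm completion_form f = 0 -> f = 0.
Proof.
move=> f0; apply: completion_eq => w; apply/eqP; rewrite -normr_le0.
by have := ev_bound f w; rewrite f0 mul0r.
Qed.

Lemma completion_dense f e : 0 < e ->
  exists v, snorm completion_form (f - embed v) <= e.
Proof.
move=> e0; have [v hv] := completion_approx f e0; exists v.
by apply: completion_snorm_le; [exact: ltW|exact: hv].
Qed.

HB.instance Definition _ := Lmodule_isNormed.Build R[i] completion
  (@snormD _ _ completion_form) (@snormZ _ _ completion_form) completion_snorm_eq0.

Lemma completion_normE f : `|f| = snorm completion_form f. Proof. by []. Qed.

(** A Cauchy filter converges pointwise, and the convergence is uniform with respect
    to [snorm b w].  The pointwise limit is therefore approximable, and it is a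
    limit in norm because the norm is the dual norm. *)
Lemma completion_complete (F : set_system completion) :
  ProperFilter F -> cauchy F -> cvg F.
Proof.
move=> FF /cauchyP Fc.
have evc (w : V) : exists c : R[i]^o, ((fun f => ev f w : R[i]^o) @ F) --> c.
  apply/cvg_ex; apply: complex_complete; apply/cauchyP => e e0.
  have w0 : 0 < snorm b w + 1 by rewrite ltr_wpDl ?snorm_ge0.
  have [f Ff] := Fc (e / (snorm b w + 1)) (divr_gt0 e0 w0).
  exists (ev f w); rewrite nbhs_filterE.
  rewrite -/((fun f => ev f w : R[i]^o) @^-1` _).
  apply: (@filterS _ F _ (ball f (e / (snorm b w + 1)))) Ff => g.
  rewrite -ball_normE /= completion_normE => fg.
  rewrite /ball /=.
  have h : `|ev f w - ev g w| <= snorm completion_form (f - g) * snorm b w.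
    exact: (ev_bound (f - g) w).
  apply: le_lt_trans h _.
  apply: (@le_lt_trans _ _ (e / (snorm b w + 1) * snorm b w)).
    by rewrite ler_wpM2r ?snorm_ge0// ltW.
  by rewrite mulrAC -mulrA gtr_pMr// ltr_pdivrMr// mul1r ltrDl.
pose phi (w : V) : R[i]^o := sval (cid (evc w)).
have phiP w : (fun f => ev f w : R[i]^o) @ F --> phi w := svalP (cid (evc w)).
have near_phi e g : 0 < e -> F (ball g e) ->
    dual_bound b (fun w => phi w - ev g w) e.
  move=> e0 Fg; rewrite /dual_bound => w.
  apply: (@ler_eps _ _ _ 1) => // d d0 _.
  have /cvgrPdist_lt/(_ _ d0) Fd := phiP w.
  have [f [fd fg]] := filter_ex (filterI Fd Fg).
  rewrite -ball_normE/= completion_normE in fg.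
  have h : `|ev g w - ev f w| <= snorm completion_form (g - f) * snorm b w.
    exact: (ev_bound (g - f) w).
  have -> : (phi w : R[i]) - ev g w = (phi w - ev f w) - (ev g w - ev f w).
    by rewrite opprB addrA subrK.
  apply: le_trans (ler_normB _ _) _; rewrite mulr1 addrC lerD//; last exact: ltW.
  by apply: le_trans h _; rewrite ler_wpM2r ?snorm_ge0// ltW.
have phi_in : approx_pred b phi.
  apply/asboolP => e e0; have e2 : 0 < e / 2 by rewrite divr_gt0.
  have [g Fg] := Fc _ e2; have [v hv] := completion_approx g e2.
  exists v; rewrite /approx (splitr e).
  rewrite (_ : (fun w => _) = (fun w => phi w - ev g w) + (fun w => ev g w - b v w)).
    exact: (dual_boundD (near_phi _ _ e2 Fg) hv).
  by apply/funext => w; rewrite [RHS]addrA subrK.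
apply/cvg_ex; exists (exist _ phi phi_in : completion); apply/fcvgrPdist_lt => e e0.
have e2 : 0 < e / 2 by rewrite divr_gt0.
have [g Fg] := Fc _ e2; apply: filterS (Fg) => h; rewrite -ball_normE/= => gh.
rewrite -[_ - h](subrKA g) (splitr e); apply: le_lt_trans (ler_normD _ _) _.
rewrite ler_ltD//; apply: (completion_snorm_le (ltW e2)); exact: near_phi.
Qed.

HB.instance Definition _ := Uniform_isComplete.Build completion completion_complete.

Lemma pairing_is_bilinear : bilinear_for
  (GRing.Scale.Law.clone _ _ *%R _) (GRing.Scale.Law.clone _ _ (Num.conj \; *%R) _)
  pairing.
Proof.
split=> [g a f h|f a g h]; first exact: (sformP completion_form).
have := sformDr completion_form f (a *: g) h.
by rewrite (sformZr completion_form).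
Qed.

HB.instance Definition _ := bilinear_isBilinear.Build R[i] completion completion R[i]
  _ _ pairing pairing_is_bilinear.

Lemma pairing_is_hermitian f g : pairing f g = (-1) ^+ false * (pairing g f)^*.
Proof. by rewrite mul1r -pairingC. Qed.

HB.instance Definition _ := isHermitianSesquilinear.Build R[i] completion false
  (@Num.conj R[i]) pairing pairing_is_hermitian.

Lemma pairing_gt0 f : f != 0 -> 0 < pairing f f.
Proof.
move=> f0; rewrite lt_def pairing_ge0 andbT; apply: contra_neq f0 => h.
by apply: completion_snorm_eq0; rewrite /snorm /= h sqrtC0.
Qed.

HB.instance Definition _ := isDotProduct.Build R[i] completion pairing pairing_gt0.

Lemma normr_pairing f : `|f| ^+ 2 = pairing f f.
Proof. by rewrite completion_normE snorm_sqr. Qed.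

HB.instance Definition _ := CompleteNormedModule_isHilbert.Build R completion
  normr_pairing.

Definition completion_hilbert : hilbertType R := completion.

End Completion.

(** * Riesz representation theorem *)

Section HilbertTheory.
Variables (R : realType) (H : hilbertType R).
Implicit Types (x y z : H) (a : R[i]).

Lemma hdotP a x y z : '[a *: x + y, z] = a * '[x, z] + '[y, z].
Proof. exact: linearPl. Qed.

Lemma hdotC x y : '[x, y] = ('[y, x])^*.
Proof. by rewrite [LHS]hermC mul1r. Qed.

Lemma hdot_ge0 x : 0 <= '[x, x].
Proof. by rewrite -normr_hdot exprn_ge0. Qed.

Definition hdot_form := SemiInner hdotP hdotC hdot_ge0.

Lemma hdotDl x y z : '[x + y, z] = '[x, z] + '[y, z].
Proof. exact: (sformDl hdot_form). Qed.
Lemma hdotBl x y z : '[x - y, z] = '[x, z] - '[y, z].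
Proof. exact: (sformBl hdot_form). Qed.
Lemma hdotZl a x z : '[a *: x, z] = a * '[x, z].
Proof. exact: (sformZl hdot_form). Qed.
Lemma hdot0l z : '[0, z] = 0.
Proof. exact: (sform0l hdot_form). Qed.
Lemma hdotDr x y z : '[x, y + z] = '[x, y] + '[x, z].
Proof. exact: (sformDr hdot_form). Qed.
Lemma hdotBr x y z : '[x, y - z] = '[x, y] - '[x, z].
Proof. exact: (sformBr hdot_form). Qed.
Lemma hdotZr a x y : '[x, a *: y] = a^* * '[x, y].
Proof. exact: (sformZr hdot_form). Qed.
Lemma hdot0r x : '[x, 0] = 0.
Proof. exact: (sform0r hdot_form). Qed.
Lemma hdot_suml I r (P : pred I) (F : I -> H) z :
  '[\sum_(i <- r | P i) F i, z] = \sum_(i <- r | P i) '[F i, z].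
Proof. exact: (sform_suml hdot_form). Qed.
Lemma hdot_sumr I r (P : pred I) (F : I -> H) x :
  '[x, \sum_(i <- r | P i) F i] = \sum_(i <- r | P i) '[x, F i].
Proof. exact: (sform_sumr hdot_form). Qed.

Lemma snorm_hdot x : snorm hdot_form x = `|x|.
Proof. by rewrite /snorm /= -normr_hdot sqrCK. Qed.

Lemma hdot_le_norm x y : `|'[x, y]| <= `|x| * `|y|.
Proof. by have := sform_le_snorm hdot_form x y; rewrite !snorm_hdot. Qed.

Lemma hdot_eqr y z : (forall x, '[x, y] = '[x, z]) -> y = z.
Proof.
move=> h; apply/eqP; rewrite -subr_eq0 -normr_eq0 -sqrf_eq0 normr_hdot.
by rewrite hdotBr h subrr.
Qed.

Lemma hdot_eql y z : (forall x, '[y, x] = '[z, x]) -> y = z.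
Proof. by move=> h; apply: hdot_eqr => x; rewrite hdotC h -hdotC. Qed.

End HilbertTheory.

(** Greatest lower bound of a real-valued function, phrased in [R[i]] so that later
    computations need no passage between [R] and [R[i]]. *)
Lemma complex_inf (R : realType) (T : Type) (E : T -> R[i]) (c : R[i]) (x0 : T) :
  c \is Num.real -> (forall x, c <= E x) -> exists m,
    (forall x, m <= E x) /\ forall e, 0 < e -> exists x, E x < m + e.
Proof.
move=> cR cE; have ER x : E x = (complex.Re (E x))%:C.
  by rewrite RRe_real// -(ler_real (cE x)).
pose A := [set complex.Re (E x) | x in [set: T]].
have Ai : has_inf A.
  split; first by exists (complex.Re (E x0)), x0.
  by exists (complex.Re c) => _ [x _ <-]; rewrite -lecR -ER RRe_real.
exists (inf A)%:C; split=> [x|e e0].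
  by rewrite ER lecR; apply: ge_inf; [case: Ai|exists x].
have eE : e = (complex.Re e)%:C by rewrite RRe_real// gtr0_real.
have e0' : 0 < complex.Re e by rewrite -ltcR -eE.
have [_ [x _ <-] h] := inf_adherent e0' Ai.
by exists x; rewrite ER eE -raddfD ltcR.
Qed.

Section Riesz.
Variables (R : realType) (H : hilbertType R) (g : H -> R[i]) (M : R[i]).
Hypothesis M_ge0 : 0 <= M.
Hypothesis g_lin : forall a x y, g (a *: x + y) = a * g x + g y.
Hypothesis g_bound : forall x, `|g x| <= M * `|x|.

Let gZ a x : g (a *: x) = a * g x.
Proof.
have g0 : g 0 = 0.
  have := g_lin 1 0 0; rewrite scaler0 addr0 mul1r => h.
  by apply: (addrI (g 0)); rewrite -h addr0.
by have := g_lin a x 0; rewrite addr0 g0 addr0.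
Qed.

(** [|x|^2 - 2 Re g(x)]: if [z] represents [g], it equals [|x - z|^2 - |z|^2] and is
    minimal at [z]. *)
Let energy (x : H) : R[i] := `|x| ^+ 2 - (g x + (g x)^*).

Let energyD x v t :
  energy (x + t *: v) = energy x + `|t| ^+ 2 * `|v| ^+ 2 +
    (t * ('[v, x] - g v) + (t * ('[v, x] - g v))^*).
Proof.
rewrite /energy [x + _]addrC g_lin !normr_hdot hdotP !hdotDr !hdotZr normCK.
by rewrite (hdotC x v) !(rmorphD, rmorphM, rmorphB)/=; ring.
Qed.

Let energy_lower x : - (M ^+ 2) <= energy x.
Proof.
have gR : g x + (g x)^* \is Num.real by apply/CrealP; rewrite rmorphD/= conjCK addrC.
have h : g x + (g x)^* <= M * `|x| *+ 2.
  apply: (le_trans (real_ler_norm gR)); apply: le_trans (ler_normD _ _) _.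
  by rewrite norm_conjC mulr2n lerD.
have r : `|x| - M \is Num.real by rewrite rpredB// ger0_real.
rewrite -subr_ge0 opprK; apply: le_trans (real_exprn_even_ge0 (n := 2) r isT) _.
rewrite /energy sqrrB lerD2r lerD2l lerN2 [leRHS](_ : _ = M * `|x| *+ 2)//.
by rewrite mulrC.
Qed.

(** By the parallelogram identity, points of almost minimal energy are close to each
    other ([diam]), so they accumulate at some [z].  Moving such a point along [v]
    cannot lower the energy by much, so the linear term of the energy in the
    direction [v] is small ([slope]); in the limit it is zero, which says that [z]
    represents [g]. *)
Lemma riesz : exists z, forall x, g x = '[x, z].
Proof.
have [|m [m_le m_near]] := complex_inf (0 : H) _ energy_lower.
  by rewrite realN ger0_real// exprn_ge0.
have diam x y e : energy x < m + e -> energy y < m + e -> `|x - y| ^+ 2 < e *+ 4.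
  move=> xe ye.
  have := m_le (2^-1 *: (x + y)).
  have -> : energy (2^-1 *: (x + y)) =
     (energy x + energy y) / 2 - `|x - y| ^+ 2 / 4.
    rewrite /energy gZ -[x + y]addrC -[y in y + x]scale1r g_lin mul1r scale1r.
    rewrite !normr_hdot hdotZl hdotZr hdotBl !hdotBr hdotDl !hdotDr.
    have h2 : (2^-1 : R[i])^* = 2^-1 by rewrite fmorphV/= conjC_nat.
    by rewrite !(rmorphM, rmorphD)/= h2; field.
  rewrite lerBrDr -lerBrDl ler_pdivrMr// => h; apply: (le_lt_trans h).
  rewrite mulrC -subr_gt0.
  have -> : e *+ 4 - 4 * ((energy x + energy y) / 2 - m) =
     (m + e - energy x + (m + e - energy y)) *+ 2 by field.
  by rewrite pmulrn_rgt0// addr_gt0// subr_gt0.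
have slope x v e : energy x < m + e ->
    `|'[v, x] - g v| ^+ 2 <= e * (`|v| ^+ 2 + 1).
  move=> xe; set a := '[v, x] - g v.
  (* The step s nearly minimises the energy on the line through x in direction v;
     the + 1 covers v = 0. *)
  pose s := (`|v| ^+ 2 + 1)^-1.
  have v1 : 0 < `|v| ^+ 2 + 1 by rewrite ltr_wpDl// exprn_ge0.
  have s0 : 0 < s by rewrite invr_gt0.
  have := m_le (x + (- s * a^*) *: v); rewrite energyD -/a.
  have -> : - s * a^* * a = - (s * `|a| ^+ 2) by rewrite normCK; ring.
  have sJ : s^* = s by apply/CrealP; rewrite gtr0_real.
  rewrite rmorphN rmorphM/= sJ (_ : (`|a| ^+ 2)^* = `|a| ^+ 2); last first.
    by apply/CrealP; rewrite ger0_real// exprn_ge0.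
  rewrite normrM normrN norm_conjC (gtr0_norm s0) exprMn => h.
  have sv : s * `|v| ^+ 2 <= 1 by rewrite mulrC ler_pdivrMr// mul1r lerDl.
  have sa : 0 <= s * `|a| ^+ 2 by rewrite mulr_ge0 ?exprn_ge0 ?(ltW s0).
  suff : s * `|a| ^+ 2 <= e by rewrite mulrC ler_pdivrMr.
  have h2 : s ^+ 2 * `|a| ^+ 2 * `|v| ^+ 2 <= s * `|a| ^+ 2.
    rewrite -[leRHS]mulr1 (_ : _ * _ * _ = s * `|a| ^+ 2 * (s * `|v| ^+ 2)).
      exact: ler_wpM2l.
    by ring.
  rewrite -(lerD2l m); apply: le_trans (lerD h (lexx _)) _.
  rewrite -subr_ge0 in h2.
  rewrite -subr_ge0.
  have -> : m + e - (energy x + s ^+ 2 * `|a| ^+ 2 * `|v| ^+ 2 +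
    (- (s * `|a| ^+ 2) - s * `|a| ^+ 2) + s * `|a| ^+ 2) = (m + e - energy x) +
    (s * `|a| ^+ 2 - s ^+ 2 * `|a| ^+ 2 * `|v| ^+ 2) by ring.
  by rewrite addr_ge0// subr_ge0 ltW.
pose F : set_system H := filter_from [set e : R[i] | 0 < e]
  (fun e => [set x | energy x < m + e]).
have FF : ProperFilter F.
  apply: decreasing_filter => [c d cd x /= xc|e /m_near//].
  by apply: lt_le_trans xc _; rewrite lerD2l.
have : cvg F.
  apply: cauchy_cvg; apply/cauchyP => e e0.
  have e4 : 0 < e ^+ 2 / 4 by rewrite divr_gt0// exprn_gt0.
  have [x xe] := m_near _ e4; exists x, (e ^+ 2 / 4) => // y /= ye.
  rewrite -ball_normE/= -(@ltr_pXn2r _ 2) ?nnegrE ?(ltW e0)//.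
  by have := diam _ _ _ xe ye; rewrite -[_ *+ 4]mulr_natr divfK ?pnatr_eq0.
move=> /cvg_ex[z /fcvgrPdist_lt Fz]; exists z => v.
apply: (@eq_eps _ _ _ (`|v| + (`|v| + 1))); first by rewrite !addr_ge0.
move=> e e0 _; have [d /= d0 dz] := Fz _ e0.
have de : 0 < d + e ^+ 2 by rewrite addr_gt0 ?exprn_gt0.
(* This tolerance is below both d and e ^+ 2. *)
have [x xe] := m_near (d * e ^+ 2 / (d + e ^+ 2))
  (divr_gt0 (mulr_gt0 d0 (exprn_gt0 2 e0)) de).
have xd : energy x < m + d.
  apply: lt_le_trans xe _; rewrite lerD2l ler_pdivrMr// ler_pM2l// lerDr.
  exact: ltW.
have xe2 : energy x < m + e ^+ 2.
  apply: lt_le_trans xe _; rewrite lerD2l ler_pdivrMr// mulrC ler_pM2l ?exprn_gt0//.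
  by rewrite lerDl exprn_ge0// ltW.
have -> : g v - '[v, z] = - ('[v, z - x] + ('[v, x] - g v)).
  by rewrite hdotBr; ring.
rewrite normrN; apply: le_trans (ler_normD _ _) _; rewrite mulrDr lerD//.
  apply: le_trans (hdot_le_norm _ _) _; rewrite mulrC ler_wpM2r//.
  exact: ltW (dz _ xd).
have v1 : 0 <= `|v| + 1 by rewrite addr_ge0.
rewrite -(@ler_pXn2r _ 2) ?nnegrE ?mulr_ge0 ?(ltW e0)//.
apply: le_trans (slope _ _ _ xe2) _; rewrite exprMn ler_wpM2l ?exprn_ge0 ?(ltW e0)//.
by rewrite sqrrD1 -addrA lerD2l lerDr mulrn_wge0.
Qed.
End Riesz.

(** * Adjoints, dense subspaces and unitaries *)

Section Adjoint.
Variables (R : realType) (H K : hilbertType R).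
Implicit Types (f : {linear H -> K}).

Lemma bounded_op_ge0 (f : H -> K) : bounded_op f ->
  exists2 M : R[i], 0 <= M & forall x, `|f x| <= M * `|x|.
Proof.
move=> [M hM]; exists `|M| => // x; apply: le_trans (hM x) _.
have h : 0 <= M * `|x| by apply: le_trans (hM x).
by rewrite -(ger0_norm h) normrM normr_id.
Qed.

Lemma adjointP f x y : bounded_op f -> '[f x, y] = '[x, adjoint f y].
Proof.
move=> /bounded_op_ge0[M M0 hM].
suff /(xgetPex 0) : exists z, forall x, '[f x, y] = '[x, z] by apply.
apply: (@riesz _ _ _ (M * `|y|)); first exact: mulr_ge0.
  by move=> a u v; rewrite linearP hdotP.
move=> u; apply: le_trans (hdot_le_norm _ _) _.
by rewrite mulrAC ler_wpM2r.
Qed.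

Lemma adjoint_eq (f : H -> K) y z :
  (forall x, '[f x, y] = '[x, z]) -> adjoint f y = z.
Proof.
move=> fz; apply: hdot_eqr => x; rewrite -fz.
suff /(xgetPex 0)/= -> : exists z, forall x, '[f x, y] = '[x, z] by [].
by exists z.
Qed.

Lemma adjointPr f x y : bounded_op f -> '[x, f y] = '[adjoint f x, y].
Proof. by move=> fb; rewrite hdotC adjointP// -hdotC. Qed.

Lemma adjoint_is_linear f : bounded_op f -> linear (adjoint f).
Proof.
move=> fb a x y; apply: adjoint_eq => u.
by rewrite !(hdotDr, hdotZr) !adjointP.
Qed.

End Adjoint.

(** Bundles a function defined inside a proof, where no instance can be declared. *)
Lemma linear_exists (R : pzRingType) (U V : lmodType R) (f : U -> V) :
  linear f -> exists g : {linear U -> V}, g =1 f.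
Proof.
move=> fl.
by exists (HB.pack_for {linear U -> V} f (GRing.isLinear.Build R U V _ f fl)).
Qed.

Lemma closure_setTP (R : realType) (K : hilbertType R) (E : set K) :
  closure E = setT <->
  forall x (e : R[i]), 0 < e -> exists2 y, E y & `|x - y| < e.
Proof.
split=> [ET x e e0|h].
  have : closure E x by rewrite ET.
  move=> /(_ (ball x e) (nbhsx_ballx _ _ e0)) [y [Ey]].
  by rewrite -ball_normE => xy; exists y.
apply/seteqP; split=> // x _ B /nbhs_normP[e /= e0 eB].
by have [y Ey xy] := h x e e0; exists y; split => //; apply: eB.
Qed.

Lemma linear_eq_dense (R : realType) (K L : hilbertType R) (E : set K)
    (F G : {linear K -> L}) :
  closure (lin_span E) = setT -> bounded_op F -> bounded_op G ->
  (forall x, E x -> F x = G x) -> F =1 G.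
Proof.
move=> /closure_setTP Ed /bounded_op_ge0[M M0 FM] /bounded_op_ge0[N N0 GN] FG x.
apply/eqP; rewrite -subr_eq0 -normr_le0.
apply: (@ler_eps _ _ _ (M + N)) => [|e e0 _]; first exact: addr_ge0.
have [y [m [c [v [Ev yE]]]] xy] := Ed x e e0.
have Fy : F y = G y.
  rewrite yE !linear_sum; apply: eq_bigr => i _.
  by rewrite !linearZ/= (FG _ (Ev i)).
have -> : F x - G x = F (x - y) - G (x - y).
  by rewrite [F (x - y)]linearB [G (x - y)]linearB Fy opprB addrA subrK.
apply: le_trans (ler_normB _ _) _; rewrite add0r mulrDr; apply: lerD.
  by rewrite (le_trans (FM _))// mulrC ler_wpM2r// ltW.
by rewrite (le_trans (GN _))// mulrC ler_wpM2r// ltW.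
Qed.

(** Extension by continuity of a map given by its graph [G].  Working with a graph
    rather than a function spares checking that a map prescribed on the vectors of
    a spanning family is well defined: the bound [G_bound] implies it. *)
Section ExtendGraph.
Variables (R : realType) (K L : hilbertType R) (G : K -> L -> Prop) (M : R[i]).
Hypothesis M_ge0 : 0 <= M.
Hypothesis G_lin : forall a k l k' l',
  G k l -> G k' l' -> G (a *: k + k') (a *: l + l').
Hypothesis G_bound : forall k l, G k l -> `|l| <= M * `|k|.
Hypothesis G_dense : forall k (e : R[i]), 0 < e ->
  exists k' l', G k' l' /\ `|k - k'| <= e.

Let cl k l := forall e : R[i], 0 < e ->
  exists k' l', [/\ G k' l', `|k - k'| <= e & `|l - l'| <= e].

Let cl_lin a k l k' l' : cl k l -> cl k' l' -> cl (a *: k + k') (a *: l + l').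
Proof.
move=> h h' e e0; have a0 : 0 < `|a| + 1 by rewrite ltr_wpDl.
have c0 : 0 < e / (`|a| + 1) by rewrite divr_gt0.
have [k1 [l1 [G1 hk1 hl1]]] := h _ c0; have [k2 [l2 [G2 hk2 hl2]]] := h' _ c0.
exists (a *: k1 + k2), (a *: l1 + l2).
have aux (W : hilbertType R) (x x1 y y1 : W) : `|x - x1| <= e / (`|a| + 1) ->
    `|y - y1| <= e / (`|a| + 1) -> `|a *: x + y - (a *: x1 + y1)| <= e.
  move=> xx yy; rewrite opprD addrACA -scalerBr; apply: le_trans (ler_normD _ _) _.
  rewrite normrZ; apply: (le_trans (lerD (ler_wpM2l (normr_ge0 a) xx) yy)).
  by rewrite le_eqVlt; apply/orP; left; apply/eqP; field; rewrite gt_eqF.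
by split; [exact: G_lin|exact: aux|exact: aux].
Qed.

Let cl_bound k l : cl k l -> `|l| <= M * `|k|.
Proof.
move=> h; apply: (@ler_eps _ _ _ (M + 1)); first exact: addr_ge0.
move=> e e0 _; have [k' [l' [G' hk hl]]] := h e e0.
have hk' : `|k'| <= `|k| + e.
  rewrite -[k'](subrK k) addrC; apply: le_trans (ler_normD _ _) _.
  by rewrite lerD2l distrC.
rewrite -[l](subrK l'); apply: le_trans (ler_normD _ _) _.
have -> : M * `|k| + e * (M + 1) = e + M * (`|k| + e) by ring.
by rewrite lerD//; apply: le_trans (G_bound G') _; rewrite ler_wpM2l.
Qed.

Let cl_fun k l l' : cl k l -> cl k l' -> l = l'.
Proof.
move=> h h'; apply/eqP; rewrite -subr_eq0 -normr_le0.
have := cl_bound (cl_lin (-1) h' h).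
by rewrite !scaleN1r addNr normr0 mulr0 addrC.
Qed.

(** The second components of pairs in [G] whose first component is close to [k] form a
    Cauchy filter, by [G_bound] applied to differences. *)
Let cl_total k : exists l, cl k l.
Proof.
pose F : set_system L := filter_from [set e : R[i] | 0 < e]
  (fun e => [set l | exists2 k', G k' l & `|k - k'| <= e]).
have FF : ProperFilter F.
  apply: decreasing_filter => [c d cd l [k' G' kk]|e /(G_dense k)].
    by exists k' => //; exact: le_trans kk cd.
  by move=> [k' [l' [G' kk]]]; exists l', k'.
have : cvg F.
  apply: cauchy_cvg; apply/cauchyP => e e0.
  have M1 : 0 < (M + 1) * 2 by rewrite mulr_gt0// ltr_wpDl.
  have d0 : 0 < e / ((M + 1) * 2) by rewrite divr_gt0.
  have [k1 [l1 [G1 kk1]]] := G_dense k d0.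
  exists l1, (e / ((M + 1) * 2)) => //= l2 [k2 G2 kk2].
  have /G_bound := G_lin (-1) G2 G1; rewrite !scaleN1r -ball_normE/= addrC => h.
  apply: le_lt_trans h _.
  have -> : - k2 + k1 = (k - k2) - (k - k1).
    by rewrite opprB [k1 - k]addrC addrA [k - k2]addrC addrK.
  apply: le_lt_trans (ler_wpM2l M_ge0 (le_trans (ler_normB _ _) (lerD kk2 kk1))) _.
  exact: modulus_lt.
move=> /cvg_ex[l /fcvgrPdist_lt Fl]; exists l => e e0.
have Fe : F [set l | exists2 k', G k' l & `|k - k'| <= e] by exists e.
have [l' [ll' [k' G' kk]]] := filter_ex (filterI (Fl _ e0) Fe).
by exists k', l'; split => //; exact: ltW.
Qed.

Lemma extend_graph : exists f : {linear K -> L},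
  (forall x, `|f x| <= M * `|x|) /\ forall k l, G k l -> f k = l.
Proof.
have [f hf] := choice cl_total.
have [g gf] : exists g : {linear K -> L}, g =1 f.
  by apply: linear_exists => a x y; apply: cl_fun (hf _) (cl_lin a (hf x) (hf y)).
exists g; split=> [x|k l Gkl]; first by rewrite gf; exact: cl_bound.
rewrite gf; apply: cl_fun (hf k) _ => e e0.
by exists k, l; split=> //; rewrite subrr normr0 ltW.
Qed.

End ExtendGraph.

(** Polarization: the real part of the inner product is determined by norms, and the
    imaginary part by the real part at ['i *: x]. *)
Lemma isometry_hdot (R : realType) (K L : hilbertType R) (U : {linear K -> L}) :
  (forall x, `|U x| = `|x|) -> forall x y, '[U x, U y] = '[x, y].
Proof.
move=> Un.
have re x y : '[U x, U y] + ('[U x, U y])^* = '[x, y] + ('[x, y])^*.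
  have := normr_hdot (U (x + y)); rewrite Un normr_hdot linearD !hdotDl !hdotDr.
  rewrite (hdotC y x) (hdotC (U y)) -!normr_hdot !Un => h.
  apply: (addrI (`|x| ^+ 2 + `|y| ^+ 2)).
  by apply: (etrans _ (etrans (esym h) _)); ring.
move=> x y; have h1 := re x y; have h2 := re ('i%R *: x) y.
move: h2; rewrite linearZ !hdotZl !rmorphM/= conjCi => h2.
have i0 : 'i%R != 0 :> R[i] by exact: neq0Ci.
have h3 : '[U x, U y] - ('[U x, U y])^* = '[x, y] - ('[x, y])^*.
  by apply: (mulfI i0); rewrite !mulrBr; move: h2; rewrite !mulNr.
have : '[U x, U y] *+ 2 = '[x, y] *+ 2.
  have -> : '[U x, U y] *+ 2 = ('[U x, U y] + ('[U x, U y])^*) +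
     ('[U x, U y] - ('[U x, U y])^*) by ring.
  by rewrite h1 h3; ring.
have n2 : 2 != 0 :> R[i] by rewrite pnatr_eq0.
by move=> h; apply: (mulIf n2); rewrite !mulr_natr.
Qed.

Section UnitaryOfGram.
Variables (R : realType) (X : Type) (K L : hilbertType R).
Variables (k : X -> K) (l : X -> L).
Hypothesis gram : forall a b, '[k a, k b] = '[l a, l b].

Let graph (x : K) (y : L) :=
  exists s : seq (R[i] * X), x = \sum_(p <- s) p.1 *: k p.2 /\
                             y = \sum_(p <- s) p.1 *: l p.2.

(** The graph is the span of the pairs [(k a, l a)]; the equality of Gram matrices
    makes it isometric. *)
Lemma isometry_of_gram : closure (lin_span [set k a | a in setT]) = setT ->
  exists U : {linear K -> L}, (forall x, `|U x| <= `|x|) /\ forall a, U (k a) = l a.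
Proof.
move=> /closure_setTP kd.
have [||x e e0|U [Ub UG]] := @extend_graph R K L graph 1 ler01 _ _ _.
- move=> a _ _ _ _ [s [-> ->]] [s' [-> ->]].
  exists ([seq (a * p.1, p.2) | p <- s] ++ s'); split.
    rewrite big_cat big_map scaler_sumr/=; congr (_ + _).
    by apply: eq_bigr => p _; rewrite scalerA.
  rewrite big_cat big_map scaler_sumr/=; congr (_ + _).
  by apply: eq_bigr => p _; rewrite scalerA.
- move=> _ _ [s [-> ->]]; rewrite mul1r le_eqVlt -(@eqrXn2 _ 2)// !normr_hdot.
  rewrite !hdot_suml; apply/orP; left; apply/eqP; apply: eq_bigr => p _.
  by rewrite !hdot_sumr; apply: eq_bigr => q _; rewrite !(hdotZl, hdotZr) gram.
- have [_ [m [c [v [kv ->]]]] xy] := kd x e e0.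
  have kv' i : exists a, k a = v i by have [a _ <-] := kv i; exists a.
  have [a av] := choice kv'.
  exists (\sum_(i < m) c i *: v i), (\sum_(i < m) c i *: l (a i)).
  split; last exact: ltW.
  exists [seq (c i, a i) | i <- index_enum 'I_m]; rewrite !big_map; split=> //.
  by apply: eq_bigr => i _; rewrite av.
exists U; split=> [x|a]; first by rewrite -[leRHS]mul1r.
by apply: UG; exists [:: (1, a)]; rewrite !big_seq1 !scale1r.
Qed.

End UnitaryOfGram.

Lemma unitary_of_gram (R : realType) (X : Type) (K L : hilbertType R)
    (k : X -> K) (l : X -> L) :
  closure (lin_span [set k a | a in setT]) = setT ->
  closure (lin_span [set l a | a in setT]) = setT ->
  (forall a b, '[k a, k b] = '[l a, l b]) ->
  exists U : {linear K -> L}, [/\ bijective U,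
    forall x y, '[U x, U y] = '[x, y] & forall a, U (k a) = l a].
Proof.
move=> kd ld gram.
have [U [Ub Uk]] := isometry_of_gram gram kd.
have [W [Wb Wl]] := isometry_of_gram (fun a b => esym (gram a b)) ld.
have cancel_on_dense (K1 K2 : hilbertType R) (k1 : X -> K1) (k2 : X -> K2)
    (U1 : {linear K1 -> K2}) (U2 : {linear K2 -> K1}) :
    closure (lin_span [set k1 a | a in setT]) = setT ->
    (forall x, `|U1 x| <= `|x|) -> (forall a, U1 (k1 a) = k2 a) ->
    (forall x, `|U2 x| <= `|x|) -> (forall a, U2 (k2 a) = k1 a) ->
    cancel U1 U2.
  move=> k1d U1b U1k U2b U2k.
  apply: (@linear_eq_dense _ _ _ _ (U2 \o U1) idfun k1d).
  - by exists 1 => x; rewrite mul1r; exact: le_trans (U2b _) (U1b _).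
  - by exists 1 => x; rewrite mul1r.
  - by move=> _ [a _ <-] /=; rewrite U1k U2k.
have UK := cancel_on_dense _ _ _ _ U W kd Ub Uk Wb Wl.
have WK := cancel_on_dense _ _ _ _ W U ld Wb Wl Ub Uk.
exists U; split=> //; first by exists W.
apply: isometry_hdot => x; apply/le_anti/andP; split=> //.
by rewrite -{1}[x]UK.
Qed.

(** * Operators on the completion *)

(** An operator [S] with adjoint [B] acts on functionals by precomposition with [B]:
    this extends [S] because [b (S v) w = b v (B w)].  Contractivity is enough for
    the operators needed here and keeps constants out of the estimates. *)
Section Lift.
Variables (R : realType) (V : lmodType R[i]) (b : semi_inner V).
Variables (S B : V -> V).
Hypothesis SB_adj : forall v w, b (S v) w = b v (B w).
Hypothesis S_contr : forall v, snorm b (S v) <= snorm b v.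
Hypothesis B_contr : forall v, snorm b (B v) <= snorm b v.

Lemma dual_bound_comp (phi : V -> R[i]) (M : R[i]) (F : V -> V) : 0 <= M ->
  (forall v, snorm b (F v) <= snorm b v) ->
  dual_bound b phi M -> dual_bound b (phi \o F) M.
Proof.
move=> M0 Fc h; rewrite /dual_bound => w; apply: le_trans (h _) _.
by rewrite ler_wpM2l.
Qed.

Lemma lifted_exists : exists L : {linear completion b -> completion b},
  forall f w, ev (L f) w = ev f (B w).
Proof.
have h (f : completion b) : approx_pred b (fun w => ev f (B w)).
  apply/asboolP => e e0; have [v hv] := completion_approx f e0; exists (S v).
  have := dual_bound_comp (ltW e0) B_contr hv.
  rewrite /approx; congr (dual_bound _ _ _); apply/funext => w /=.
  by rewrite SB_adj.
pose L f : completion b := exist _ (fun w => ev f (B w) : R[i]^o) (h f).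
have [g gE] : exists g : {linear completion b -> completion b}, g =1 L.
  by apply: linear_exists => a f g; apply: completion_eq.
by exists g => f w; rewrite gE.
Qed.

Variables L L' : completion b -> completion b.
Hypothesis LE : forall f w, ev (L f) w = ev f (B w).
Hypothesis L'E : forall f w, ev (L' f) w = ev f (S w).

Lemma lifted_norm f : `|L f| <= `|f|.
Proof.
apply: completion_snorm_le; first exact: snorm_ge0.
have := dual_bound_comp (snorm_ge0 _ f) B_contr (ev_bound f).
by congr (dual_bound _ _ _); apply/funext => w /=; rewrite LE.
Qed.

Lemma lifted_embed v : L (embed b v) = embed b (S v).
Proof. by apply: completion_eq => w; rewrite LE !ev_embed SB_adj. Qed.

(** Let [w] approximate [g].  Then [B w] approximates [g \o S], which is [L' g], and
    both sides are close to [ev f (B w)]. *)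
Lemma lifted_pairing f g : pairing (L f) g = pairing f (L' g).
Proof.
have [M M0 fM] := completion_bounded f.
apply: (@eq_eps _ _ _ (M *+ 2)); first by rewrite mulrn_wge0.
move=> e e0 _; have [w hw] := completion_approx g e0.
have LfM : dual_bound b (ev (L f)) M.
  have := dual_bound_comp M0 B_contr fM.
  by congr (dual_bound _ _ _); apply/funext => u /=; rewrite LE.
have L'gw : approx b (ev (L' g)) (B w) e.
  have := dual_bound_comp (ltW e0) S_contr hw.
  rewrite /approx; congr (dual_bound _ _ _); apply/funext => u /=.
  by rewrite L'E [b w _]sformC SB_adj -sformC.
have h1 := pairingP M0 (ltW e0) LfM hw.
have h2 := pairingP M0 (ltW e0) fM L'gw.
have -> : pairing (L f) g - pairing f (L' g) =
   (pairing (L f) g - ev (L f) w) - (pairing f (L' g) - ev f (B w)).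
  by rewrite LE; ring.
apply: le_trans (ler_normB _ _) _; rewrite mulrnAr mulr2n [e * M]mulrC.
exact: lerD.
Qed.

End Lift.

(** * The space of words *)

Section WordSpace.
Variables (C : pzRingType) (n : nat) (A : 'M[bool]_n) (W : lmodType C).
Variable Q : 'I_n -> {linear W -> W}.
Implicit Types (x y : seq 'I_n -> W) (h : W) (i j k : 'I_n) (s : seq 'I_n).

Definition admissible s := sorted (fun i j => A i j) s.

Definition tail_from m x := forall s j, (m <= size s)%N -> x (rcons s j) = Q j (x s).

(** The families that record vectors of the dilation space.  [x s] stands for the
    defect component of [S_s^* x], and from some length on for [S_s^* x] itself. *)
Definition word_fun x := (forall s, ~~ admissible s -> x s = 0) /\
  exists m, tail_from m x.

Definition strip j x : seq 'I_n -> W := fun s => x (j :: s).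

Lemma tail_from_le m p x : (m <= p)%N -> tail_from m x -> tail_from p x.
Proof. by move=> mp h s j /(leq_trans mp); exact: h. Qed.

Lemma tail_from_strip m j x : tail_from m.+1 x -> tail_from m (strip j x).
Proof. by move=> h s k ms; rewrite /strip -rcons_cons h. Qed.

Lemma tail_fromP m a x y : tail_from m x -> tail_from m y -> tail_from m (a *: x + y).
Proof.
move=> tx ty s j ms.
rewrite -[LHS]/(a *: x (rcons s j) + y (rcons s j)) tx// ty//.
by rewrite -linearP.
Qed.

Definition word_pred : {pred (seq 'I_n -> W)} := fun x => `[< word_fun x >].

Lemma word_fun_submod : submod_closed word_pred.
Proof.
split=> [|a x y].
  by apply/asboolP; split=> //; exists 0%N => s j _; rewrite [RHS]linear0.
move=> /asboolP[xA [m xm]] /asboolP[yA [p yp]]; apply/asboolP; split=> [s As|].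
  by rewrite -[LHS]/(a *: x s + y s) xA// yA// scaler0 addr0.
exists (maxn m p); apply: tail_fromP.
  exact: (tail_from_le (leq_maxl _ _) xm).
exact: (tail_from_le (leq_maxr _ _) yp).
Qed.

HB.instance Definition _ := GRing.isSubmodClosed.Build C (seq 'I_n -> W)
  word_pred word_fun_submod.

Definition word_space := {x : seq 'I_n -> W | word_pred x}.

HB.instance Definition _ := [isSub for (@sval _ _ : word_space -> _)].
HB.instance Definition _ := [Choice of word_space by <:].
HB.instance Definition _ := [SubChoice_isSubLmodule of word_space by <:].

Implicit Types u v w : word_space.

Lemma word_spaceP u : word_fun (val u).
Proof. exact/asboolP/(valP u). Qed.

Lemma word_space_eq u v : val u =1 val v -> u = v.
Proof. by move=> uv; apply/val_inj/funext. Qed.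

Lemma word_space_out u s : ~~ admissible s -> val u s = 0.
Proof. by have [h _] := word_spaceP u; exact: h. Qed.

Definition depth u : nat := sval (cid (word_spaceP u).2).

Lemma depthP u : tail_from (depth u) (val u).
Proof. exact: svalP (cid (word_spaceP u).2). Qed.

Definition create_fun i x : seq 'I_n -> W := fun s =>
  if s is j :: s' then if (j == i) && admissible s then x s' else 0 else 0.

Lemma admissible_tail j s : admissible (j :: s) -> admissible s.
Proof. by rewrite /admissible /=; case: s => //= k s /andP[]. Qed.

Lemma admissible_rcons s j : admissible (rcons s j) -> admissible s.
Proof. by case: s => //= k s; rewrite /admissible /= rcons_path => /andP[]. Qed.

(** Prefixing shifts by one the length from which the tail condition holds.  One more
    letter is spent so that the word after the prefixed letter is not empty: the
    transition out of that letter is then settled before a letter is appended. *)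
Lemma create_subproof i u : word_pred (create_fun i (val u)).
Proof.
apply/asboolP; split=> [[|j s] // js|].
  by rewrite /create_fun (negPf js) andbF.
exists (depth u).+2 => -[|j [|k s]] // l us.
have us' : (depth u <= size (k :: s))%N by exact: ltnW.
have -> : create_fun i (val u) (rcons [:: j, k & s] l) =
  if (j == i) && admissible (rcons [:: j, k & s] l) then val u (rcons (k :: s) l)
  else 0 by [].
have -> : create_fun i (val u) [:: j, k & s] =
  if (j == i) && admissible [:: j, k & s] then val u (k :: s) else 0 by [].
have [_|_] := eqVneq j i; last by rewrite linear0.
rewrite !andTb.
have [h|h] := boolP (admissible (rcons [:: j, k & s] l)).
  by rewrite (admissible_rcons h) depthP.
case: ifP => h'; last by rewrite linear0.
rewrite -depthP// word_space_out//; apply: contra h.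
by move: h'; rewrite /admissible /= => /andP[-> _].
Qed.

Definition create i u : word_space :=
  exist _ (create_fun i (val u)) (create_subproof i u).

Lemma annihilate_subproof i u : word_pred (strip i (val u)).
Proof.
apply/asboolP; split=> [s As|].
  by rewrite /strip word_space_out//; apply: contra As; exact: admissible_tail.
exists (depth u); apply: tail_from_strip.
exact: (tail_from_le (leqnSn _) (depthP (u := u))).
Qed.

Definition annihilate i u : word_space :=
  exist _ (strip i (val u)) (annihilate_subproof i u).

Lemma create_is_linear i : linear (create i).
Proof.
move=> a u v; apply: word_space_eq => -[|j s] /=.
  by rewrite -[RHS]/(a *: 0 + 0) scaler0 addr0.
rewrite -[RHS]/(a *: create_fun i (val u) (j :: s) + create_fun i (val v) (j :: s)) /=.
by case: ifP => // _; rewrite scaler0 addr0.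
Qed.

HB.instance Definition _ i := GRing.isLinear.Build C word_space word_space _
  (create i) (create_is_linear i).

Lemma annihilate_is_linear i : linear (annihilate i).
Proof. by move=> a u v; apply: word_space_eq. Qed.

HB.instance Definition _ i := GRing.isLinear.Build C word_space word_space _
  (annihilate i) (annihilate_is_linear i).

Hypothesis Q_rel : forall i j (x : W), ~~ A i j -> Q j (Q i x) = 0.

Definition trajectory_fun h : seq 'I_n -> W := foldl (fun g j => Q j g) h.

(** The first inadmissible transition annihilates the vector by [Q_rel], and linear
    maps keep it zero. *)
Lemma trajectory_subproof h : word_pred (trajectory_fun h).
Proof.
apply/asboolP; split.
  case=> // i s; elim: s i h => // j s IH i h /=.
  rewrite negb_and => /orP[ij|js]; last exact: IH.
  rewrite /trajectory_fun /= Q_rel//.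
  by elim: s {IH} => // k s IH; rewrite /= linear0.
by exists 0%N => s j _; rewrite /trajectory_fun foldl_rcons.
Qed.

Definition trajectory h : word_space :=
  exist _ (trajectory_fun h) (trajectory_subproof h).

Lemma trajectory_is_linear : linear trajectory.
Proof.
move=> a g h; apply: word_space_eq => s.
rewrite -[RHS]/(a *: trajectory_fun g s + trajectory_fun h s) /= /trajectory_fun.
by elim: s g h => //= j s IH g h; rewrite linearP IH.
Qed.

HB.instance Definition _ := GRing.isLinear.Build C W word_space _
  trajectory trajectory_is_linear.

Lemma annihilate_trajectory i h : annihilate i (trajectory h) = trajectory (Q i h).
Proof. exact: word_space_eq. Qed.

Lemma annihilate_create_neq i j u : i != j -> annihilate i (create j u) = 0.
Proof.
by move=> ij; apply: word_space_eq => s; rewrite /= /strip /= (negPf ij).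
Qed.

Lemma annihilate_createE i u s :
  val (annihilate i (create i u)) s = if admissible (i :: s) then val u s else 0.
Proof. by rewrite /= /strip /= eqxx. Qed.

(** [annihilate i \o create i] deletes the words that may not follow [i]; it acts on
    the part starting with [k] as the scalar [A i k]. *)
Lemma annihilate2_create i k u : annihilate k (annihilate i (create i u)) =
  (A i k)%:R *: annihilate k u.
Proof.
apply: word_space_eq => s.
rewrite -[RHS]/((A i k)%:R *: val u (k :: s)).
rewrite [LHS]annihilate_createE /admissible /=.
case: (A i k) => /=; last by rewrite scale0r.
by rewrite scale1r; case: ifPn => // ks; rewrite word_space_out.
Qed.

Lemma annihilate_create i u : annihilate i (create i u) =
  u - \sum_j (1 - (A i j)%:R) *: create j (annihilate j u).
Proof.
apply: word_space_eq => s.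
have -> : val (u - \sum_j (1 - (A i j)%:R) *: create j (annihilate j u)) s =
    val u s - \sum_j (1 - (A i j)%:R) *: val (create j (annihilate j u)) s.
  rewrite -[LHS]/(val u s - val (\sum_j (1 - (A i j)%:R) *: create j (annihilate j u)) s).
  congr (_ - _); apply: (big_morph (fun w : word_space => val w s)) => //.
rewrite annihilate_createE; case: s => [|k s] /=.
  by rewrite big1 ?subr0// => j _; rewrite scaler0.
rewrite (bigD1 k)//= eqxx big1 ?addr0; last first.
  by move=> j jk; rewrite eq_sym (negPf jk) scaler0.
rewrite /admissible /=; case: (A i k) => /=; first last.
  rewrite subr0 scale1r /strip; case: ifPn => [_|]; first by rewrite subrr.
  by move=> ks; rewrite word_space_out// subrr.
by rewrite subrr scale0r subr0; case: ifPn => // ks; rewrite word_space_out.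
Qed.

(** The word space is spanned by the [create]-images of trajectories.  A family whose
    tail condition holds from length 0 is a trajectory.  Otherwise [x] with
    [h := x [::]] is [trajectory h] plus, for each letter [j], the [create j]-image
    of the correction [annihilate j x - trajectory (Q j h)], whose tail condition
    holds one letter earlier. *)
Lemma word_space_ind (P : word_space -> Prop) :
  (forall u v, P u -> P v -> P (u + v)) -> (forall h, P (trajectory h)) ->
  (forall i u, P u -> P (create i u)) -> forall u, P u.
Proof.
move=> PD PV PC u; move: (depth u) (depthP (u := u)) => m.
elim: m u => [|m IH] u um.
  suff -> : u = trajectory (val u [::]) by [].
  apply: word_space_eq; apply: last_ind => // s j IHs.
  by rewrite um// IHs /= /trajectory_fun foldl_rcons.
pose h := val u [::].
have -> : u = trajectory h + \sum_j create j (annihilate j u - trajectory (Q j h)).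
  apply: word_space_eq => s.
  rewrite -[RHS]/(trajectory_fun h s +
    val (\sum_j create j (annihilate j u - trajectory (Q j h))) s).
  have -> : val (\sum_j create j (annihilate j u - trajectory (Q j h))) s =
    \sum_j val (create j (annihilate j u - trajectory (Q j h))) s.
    exact: (big_morph (fun w : word_space => val w s)).
  case: s => [|k s] /=; first by rewrite big1// addr0.
  rewrite (bigD1 k)//= eqxx big1 ?addr0/=; last first.
    by move=> j jk; rewrite eq_sym (negPf jk).
  case: ifPn => As; last first.
    by rewrite addr0 -[RHS]/(val (trajectory h) (k :: s)) !word_space_out.
  by rewrite addrC -[X in X + _]/(val u (k :: s) - trajectory_fun (Q k h) s) subrK.
apply: (PD) => //.
have P0 : P 0 by rewrite -[0](linear0 trajectory); exact: PV.
apply: big_ind => [//||j _]; first exact: PD.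
apply: PC; apply: (PD).
  by apply: IH; exact: tail_from_strip.
by rewrite -linearN; exact: PV.
Qed.

End WordSpace.

(** * The inner product on words *)

Section WordForm.
Variables (R : realType) (n : nat) (A : 'M[bool]_n) (H : hilbertType R).
Variable (Q : 'I_n -> {linear H -> H}).
Hypothesis Q_rel : forall i j x, ~~ A i j -> Q j (Q i x) = 0.
Hypothesis Q_contr : forall x : H, 0 <= '[x, x] - \sum_i '[Q i x, Q i x].

Implicit Types (x y : seq 'I_n -> H) (h : H) (i j k : 'I_n) (s : seq 'I_n).
Implicit Types u v w : word_space A Q.

(** The form of the defect operator [1 - \sum_i T_i T_i^*], where [Q i] is [T_i^*]. *)
Definition defect_form (g h : H) : R[i] := '[g, h] - \sum_i '[Q i g, Q i h].

(** [\sum_(|s| < m) defect_form (x s) (y s) + \sum_(|s| = m) '[x s, y s]], organised by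
    the first letter of [s] so that it recurses along [strip]. *)
Fixpoint level_form m x y : R[i] :=
  if m is m'.+1 then
    defect_form (x [::]) (y [::]) + \sum_j level_form m' (strip j x) (strip j y)
  else '[x [::], y [::]].

Lemma defect_formP a (g h k : H) :
  defect_form (a *: g + h) k = a * defect_form g k + defect_form h k.
Proof.
rewrite /defect_form hdotP.
under eq_bigr do rewrite linearP hdotP.
by rewrite big_split -mulr_sumr/=; ring.
Qed.

Lemma defect_formC (g h : H) : defect_form g h = (defect_form h g)^*.
Proof.
rewrite /defect_form rmorphB rmorph_sum/= -hdotC; congr (_ - _).
by apply: eq_bigr => i _; exact: hdotC.
Qed.

Lemma level_formP m a x y z :
  level_form m (a *: x + y) z = a * level_form m x z + level_form m y z.
Proof.
elim: m x y z => [|m IH] x y z /=; first exact: hdotP.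
have -> : \sum_j level_form m (strip j (a *: x + y)) (strip j z) =
    a * (\sum_j level_form m (strip j x) (strip j z)) +
    \sum_j level_form m (strip j y) (strip j z).
  by rewrite mulr_sumr -big_split; apply: eq_bigr => j _; exact: IH.
by rewrite [defect_form _ _]defect_formP; ring.
Qed.

Lemma level_formC m x y : level_form m x y = (level_form m y x)^*.
Proof.
elim: m x y => [|m IH] x y /=; first exact: hdotC.
rewrite [RHS]rmorphD/= [X in _ = _ + X]rmorph_sum/= -defect_formC; congr (_ + _).
by apply: eq_bigr => j _; exact: IH.
Qed.

Lemma level_form_ge0 m x : 0 <= level_form m x x.
Proof.
elim: m x => [|m IH] x /=; first exact: hdot_ge0.
by rewrite addr_ge0 ?Q_contr// sumr_ge0.
Qed.

(** One more level replaces ['[g, h]] at each word of length [m] by its decomposition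
    [defect_form g h + \sum_j '[Q j g, Q j h]]. *)
Lemma level_form_stable m p x y : tail_from Q m x -> tail_from Q m y ->
  level_form (m + p) x y = level_form m x y.
Proof.
have step q x' y' : tail_from Q q x' -> tail_from Q q y' ->
    level_form q.+1 x' y' = level_form q x' y'.
  elim: q x' y' => [|q IH] x' y' tu tv.
    rewrite /= /defect_form -addrA -[RHS]addr0; congr (_ + _).
    rewrite -sumrN -big_split big1// => i _ /=.
    by rewrite /strip -(tu [::] i)// -(tv [::] i)// addNr.
  rewrite [LHS]/= [RHS]/=; congr (_ + _); apply: eq_bigr => j _.
  by apply: IH; apply: tail_from_strip.
move=> tx ty; elim: p => [|p IH]; first by rewrite addn0.
by rewrite addnS step//; apply: (tail_from_le (leq_addr _ _)).
Qed.

Definition word_dot u v : R[i] := level_form (maxn (depth u) (depth v)) (val u) (val v).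

Lemma word_dotE m u v : tail_from Q m (val u) -> tail_from Q m (val v) ->
  word_dot u v = level_form m (val u) (val v).
Proof.
move=> um vm; rewrite /word_dot; set p := maxn _ _.
have up : tail_from Q p (val u) by exact: (tail_from_le (leq_maxl _ _) (depthP (u := u))).
have vp : tail_from Q p (val v) by exact: (tail_from_le (leq_maxr _ _) (depthP (u := v))).
by rewrite -(level_form_stable m up vp) addnC (level_form_stable p um vm).
Qed.

Lemma word_dotP a u v w : word_dot (a *: u + v) w = a * word_dot u w + word_dot v w.
Proof.
pose m := maxn (depth u) (maxn (depth v) (depth w)).
have um : tail_from Q m (val u) by exact: (tail_from_le (leq_maxl _ _) (depthP (u := u))).
have vm : tail_from Q m (val v).
  by apply: (tail_from_le _ (depthP (u := v))); rewrite /m maxnCA leq_maxl.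
have wm : tail_from Q m (val w).
  by apply: (tail_from_le _ (depthP (u := w))); rewrite /m maxnA leq_maxr.
rewrite (word_dotE um wm) (word_dotE vm wm) -level_formP.
by rewrite (word_dotE (m := m))//; exact: tail_fromP.
Qed.

Lemma word_dotC u v : word_dot u v = (word_dot v u)^*.
Proof. by rewrite /word_dot maxnC level_formC. Qed.

Lemma word_dot_ge0 u : 0 <= word_dot u u.
Proof. exact: level_form_ge0. Qed.

Definition word_form := SemiInner word_dotP word_dotC word_dot_ge0.

Lemma word_dot_trajectory g h :
  word_dot (trajectory Q_rel g) (trajectory Q_rel h) = '[g, h].
Proof.
by rewrite (word_dotE (m := 0%N))// => s j _; rewrite /= /trajectory_fun foldl_rcons.
Qed.

Lemma word_dot_rec u v : word_dot u v =
  defect_form (val u [::]) (val v [::]) +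
  \sum_j word_dot (annihilate j u) (annihilate j v).
Proof.
pose m := maxn (depth u) (depth v).
have um : tail_from Q m (val u) by exact: (tail_from_le (leq_maxl _ _) (depthP (u := u))).
have vm : tail_from Q m (val v) by exact: (tail_from_le (leq_maxr _ _) (depthP (u := v))).
have um1 := tail_from_le (leqnSn m) um; have vm1 := tail_from_le (leqnSn m) vm.
rewrite (word_dotE um1 vm1) /=; congr (_ + _); apply: eq_bigr => j _.
by rewrite (word_dotE (m := m))//; exact: tail_from_strip.
Qed.

(** [annihilate j \o create i] vanishes for [j != i], which leaves the pairing of
    [annihilate i (create i u)] with [annihilate i v].  The first factor differs
    from [u] only on words that may not follow [i], where the second vanishes. *)
Lemma create_adj i u v : word_dot (create i u) v = word_dot u (annihilate i v).
Proof.
rewrite word_dot_rec (bigD1 i)//= big1 ?addr0; last first.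
  by move=> j ji; rewrite annihilate_create_neq//; exact: (sform0l word_form).
rewrite /defect_form hdot0l big1 ?subrr ?add0r; last first.
  by move=> j _; rewrite linear0 hdot0l.
rewrite word_dot_rec [RHS]word_dot_rec; congr (_ + _).
  by rewrite annihilate_createE.
apply: eq_bigr => k _; rewrite annihilate2_create.
have [Aik|Aik] := boolP (A i k); first by rewrite scale1r.
have -> : annihilate k (annihilate i v) = 0.
  apply: word_space_eq => s; rewrite /= /strip word_space_out//.
  by rewrite /admissible /= (negPf Aik).
exact: (etrans (sform0r word_form _) (esym (sform0r word_form _))).
Qed.

Lemma annihilate_contr i u :
  snorm word_form (annihilate i u) <= snorm word_form u.
Proof.
rewrite ler_sqrtC ?qualifE/= ?word_dot_ge0//.
rewrite [leRHS]word_dot_rec (bigD1 i)//= addrCA lerDl addr_ge0//; first exact: Q_contr.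
by apply: sumr_ge0 => j _; exact: word_dot_ge0.
Qed.

(** [|create i u|^2] is the pairing of [u] with [annihilate i (create i u)], at most
    [|u| |create i u|]. *)
Lemma create_contr i u : snorm word_form (create i u) <= snorm word_form u.
Proof.
have h : snorm word_form (create i u) ^+ 2 <=
    snorm word_form u * snorm word_form (create i u).
  rewrite snorm_sqr /= create_adj.
  rewrite -[leLHS]ger0_norm -?create_adj ?word_dot_ge0// create_adj.
  apply: le_trans (sform_le_snorm word_form _ _) _.
  by rewrite ler_wpM2l ?snorm_ge0// annihilate_contr.
have [->|c0] := eqVneq (snorm word_form (create i u)) 0; first exact: snorm_ge0.
by move: h; rewrite expr2 ler_pM2r// lt_def c0 snorm_ge0.
Qed.

End WordForm.

(** * Cuntz-Krieger tuples *)

Section CuntzKrieger.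
Variables (R : realType) (n : nat) (A : 'M[bool]_n) (K : hilbertType R).
Variable S : 'I_n -> {linear K -> K}.
Hypothesis S_bounded : forall i, bounded_op (S i).
Hypothesis S_rel : A_relations A S.
Hypothesis S_ck : forall i x, adjoint (S i) (S i x) =
  x - \sum_(j < n) (1 - (A i j)%:R) *: S j (adjoint (S j) x).

(** Apply [S i] to the Cuntz-Krieger relation: by the [A]-relations the terms of the sum
    with [A i j] false vanish, and the others have coefficient 0. *)
Lemma ck_S_adjoint_S i x : S i (adjoint (S i) (S i x)) = S i x.
Proof.
rewrite S_ck linearB linear_sum/= big1 ?subr0// => j _.
rewrite linearZ/= S_rel; case: (A i j); last by rewrite scale0r scaler0.
by rewrite subrr scale0r.
Qed.

(** [x - S_i^* S_i x] is in the kernel of [S i]; orthogonality of [x] to it reads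
    [|x| = |S i x|]. *)
Lemma ck_partial_isometry i : partial_isometry (S i).
Proof.
move=> x xker; have := xker (x - adjoint (S i) (S i x)).
rewrite linearB/= ck_S_adjoint_S subrr => /(_ erefl); rewrite hdotBr => /eqP.
rewrite subr_eq0 -adjointP// -!normr_hdot => /eqP h.
by apply/eqP; rewrite -(@eqrXn2 _ 2)// h.
Qed.

Hypothesis S_orth : forall i j, i != j -> forall x y, '[S i x, S j y] = 0.

Lemma ck_adjoint_neq i j x : i != j -> adjoint (S i) (S j x) = 0.
Proof. by move=> ij; apply: adjoint_eq => y; rewrite S_orth// hdot0r. Qed.

Lemma ck_adjoint_comp i l x : adjoint (S i) (S i (S l x)) = (A i l)%:R *: S l x.
Proof.
rewrite S_ck (bigD1 l)//= big1 ?addr0 => [|j jl]; last first.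
  by rewrite ck_adjoint_neq// linear0 scaler0.
by rewrite ck_S_adjoint_S scalerBl scale1r opprB addrC subrK.
Qed.

Lemma row_sum_hdotE x y :
  '[row_sum S x, y] = \sum_i '[adjoint (S i) x, adjoint (S i) y].
Proof. by rewrite hdot_suml; apply: eq_bigr => i _; rewrite adjointP. Qed.

Lemma row_sum_selfadjoint x y : '[row_sum S x, y] = '[x, row_sum S y].
Proof.
rewrite [RHS]hdotC !row_sum_hdotE rmorph_sum/=.
by apply: eq_bigr => i _; rewrite -hdotC.
Qed.

Lemma row_sum_linear : linear (row_sum S).
Proof.
move=> a x y; rewrite /row_sum scaler_sumr -big_split; apply: eq_bigr => i _.
by rewrite (adjoint_is_linear (S_bounded i)) linearP.
Qed.

Lemma row_sum_range i x : row_sum S (S i x) = S i x.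
Proof.
rewrite /row_sum (bigD1 i)//= big1 ?addr0 ?ck_S_adjoint_S// => j ji.
by rewrite ck_adjoint_neq// linear0.
Qed.

Lemma row_sum_idem x : row_sum S (row_sum S x) = row_sum S x.
Proof.
have [P PE] := linear_exists row_sum_linear.
rewrite -[LHS]PE {2}/row_sum linear_sum; apply: eq_bigr => i _.
by rewrite PE row_sum_range.
Qed.

Lemma row_sum_le x : `|row_sum S x| <= `|x|.
Proof.
have [->|x0] := eqVneq (row_sum S x) 0; first by rewrite normr0.
rewrite -(@ler_pM2r _ `|row_sum S x|) ?normr_gt0// -expr2.
rewrite -[leLHS]ger0_norm ?exprn_ge0// normr_hdot row_sum_selfadjoint row_sum_idem.
exact: hdot_le_norm.
Qed.

End CuntzKrieger.

(** * Cuntz-Krieger dilations: uniqueness and unitality *)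

Section Dilation.
Variables (R : realType) (n : nat) (A : 'M[bool]_n) (H K : hilbertType R).
Variables (J : {linear H -> K}) (T : 'I_n -> {linear H -> H}).
Variable S : 'I_n -> {linear K -> K}.
Hypothesis T_bounded : forall i, bounded_op (T i).
Hypothesis JTS : dilation J T S.
Hypothesis S_CK : cuntz_krieger A S.

Let J_iso : forall x y, '[J x, J y] = '[x, y]. Proof. by case: JTS. Qed.
Let S_bounded : forall i, bounded_op (S i). Proof. by case: JTS. Qed.
Let SJ : forall i h, adjoint (S i) (J h) = J (adjoint (T i) h). Proof. by case: JTS. Qed.
Let S_orth : forall i j, i != j -> forall x y, '[S i x, S j y] = 0.
Proof. by case: S_CK. Qed.
Let S_rel : A_relations A S. Proof. by case: S_CK. Qed.
Let S_ck : forall i x, adjoint (S i) (S i x) =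
  x - \sum_(j < n) (1 - (A i j)%:R) *: S j (adjoint (S j) x).
Proof. by case: S_CK. Qed.

Lemma hdot_J_word s h k : '[J h, word S s (J k)] =
  '[foldl (fun g j => adjoint (T j) g) h s, k].
Proof.
by elim: s h => [|j s IH] h /=; [exact: J_iso|rewrite adjointPr// SJ IH].
Qed.

(** With [hdot_J_word] and [hdot_word1_eq], these identities reduce the inner product
    of two words to inner products against a shorter second word. *)
Lemma hdot_word_eq i l s h x :
  '[word S (i :: l :: s) (J h), S i x] = (A i l)%:R * '[word S (l :: s) (J h), x].
Proof. by rewrite /= adjointPr// (ck_adjoint_comp S_rel S_ck S_orth) hdotZl. Qed.

Lemma hdot_word1_eq i h x : '[word S [:: i] (J h), S i x] =
  '[J h, x] - \sum_j (1 - (A i j)%:R) * '[word S [:: j] (J (adjoint (T j) h)), x].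
Proof.
rewrite /= adjointPr// S_ck hdotBl hdot_suml; congr (_ - _).
by apply: eq_bigr => j _; rewrite hdotZl SJ.
Qed.

Lemma row_sum_dilation h k : '[row_sum S (J h), J k] = '[row_sum T h, k].
Proof.
rewrite !row_sum_hdotE//; apply: eq_bigr => i _.
by rewrite !SJ J_iso.
Qed.

(** If [T] is unital then [row_sum S] fixes [J h]: being a projection whose compression
    to [H] is the identity, it preserves the norm of [J h].  It also fixes the range
    of each [S i], hence every word, hence everything by minimality. *)
Lemma unital_dilation : minimal J S -> (unital S <-> unital T).
Proof.
move=> S_min; split=> [S1 h|T1 x].
  by apply: hdot_eql => k; rewrite -row_sum_dilation S1 J_iso.
have rowJ h : row_sum S (J h) = J h.
  apply/eqP; rewrite -subr_eq0 -normr_eq0 -sqrf_eq0 normr_hdot.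
  rewrite hdotBl !hdotBr row_sum_selfadjoint// (row_sum_idem S_bounded S_rel S_ck S_orth).
  rewrite row_sum_selfadjoint// subrr sub0r oppr_eq0 subr_eq0.
  by rewrite -row_sum_selfadjoint// row_sum_dilation T1 J_iso.
have [P PE] := linear_exists (row_sum_linear S_bounded).
have row_word s h : row_sum S (word S s (J h)) = word S s (J h).
  by case: s => [|i s] //=; exact: (row_sum_range S_rel S_ck S_orth).
rewrite -PE; apply: (@linear_eq_dense _ _ _ _ P idfun S_min).
- exists 1 => y; rewrite mul1r PE.
  exact: (row_sum_le S_bounded S_rel S_ck S_orth).
- by exists 1 => y; rewrite mul1r.
- by move=> _ [s [h ->]]; rewrite PE row_word.
Qed.

End Dilation.

(** The Gram matrices agree by induction on the second word, for all first words at
    once, since stripping a common first letter may produce one-letter first words. *)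
Lemma dilation_unique (R : realType) (n : nat) (A : 'M[bool]_n)
    (H K1 K2 : hilbertType R) (T : 'I_n -> {linear H -> H})
    (J1 : {linear H -> K1}) (S1 : 'I_n -> {linear K1 -> K1})
    (J2 : {linear H -> K2}) (S2 : 'I_n -> {linear K2 -> K2}) :
  minimal_CK_dilation A J1 T S1 -> minimal_CK_dilation A J2 T S2 ->
  dilation_equiv J1 S1 J2 S2.
Proof.
move=> [D1 M1 C1] [D2 M2 C2].
have gram t s h k : '[word S1 s (J1 h), word S1 t (J1 k)] =
    '[word S2 s (J2 h), word S2 t (J2 k)].
  elim: t s h k => [|j t IH] s h k.
    by rewrite hdotC [RHS]hdotC (hdot_J_word D1) (hdot_J_word D2).
  case: s => [|i s]; first by rewrite (hdot_J_word D1) (hdot_J_word D2).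
  have [<-|ij] := eqVneq i j; last first.
    by have [_ -> //] := C1; have [_ -> //] := C2.
  case: s => [|l s].
    rewrite (hdot_word1_eq D1 C1) (hdot_word1_eq D2 C2).
    by rewrite (IH [::]); congr (_ - _); apply: eq_bigr => p _; rewrite (IH [:: p]).
  by rewrite (hdot_word_eq D1 C1) (hdot_word_eq D2 C2) IH.
have rangeE (K : hilbertType R) (J : {linear H -> K}) (S : 'I_n -> {linear K -> K}) :
    [set x | exists a h, x = word S a (J h)] =
    [set word S p.1 (J p.2) | p in [set: seq 'I_n * H]].
  apply/seteqP; split=> [_ [a [h ->]]|_ [[a h] _ <-]]; last by exists a, h.
  by exists (a, h).
have d1 := M1; have d2 := M2; rewrite /minimal !rangeE in d1 d2.
have [U [Ubij Uiso UE]] := unitary_of_gram d1 d2 (fun p q => gram q.1 p.1 p.2 q.2).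
exists U; split=> // [h|i x]; first exact: (UE ([::], h)).
have Un z : `|U z| = `|z| by apply/eqP; rewrite -(@eqrXn2 _ 2)// !normr_hdot Uiso.
have [_ S1b _] := D1; have [_ S2b _] := D2.
have [c1 hc1] := S1b i; have [c2 hc2] := S2b i.
apply: (@linear_eq_dense _ _ _ _ (U \o S1 i) (S2 i \o U) M1).
- by exists c1 => y; rewrite /= Un.
- by exists c2 => y; rewrite /= (le_trans (hc2 _))// Un.
- move=> _ [s [h ->]] /=; rewrite (UE (s, h)).
  by rewrite -[S1 i _]/(word S1 (i :: s) (J1 h)) (UE (i :: s, h)).
Qed.

(** * Existence of the dilation *)

Section AdjointTuple.
Variables (R : realType) (n : nat) (A : 'M[bool]_n) (H : hilbertType R).
Variable T : 'I_n -> {linear H -> H}.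
Hypothesis T_bounded : forall i, bounded_op (T i).
Hypothesis T_contr : contractive T.
Hypothesis T_rel : A_relations A T.

Lemma adjoint_linear_exists : exists Q : 'I_n -> {linear H -> H},
  forall i x, Q i x = adjoint (T i) x.
Proof.
have aux i : exists q : {linear H -> H}, q =1 adjoint (T i).
  exact: linear_exists (adjoint_is_linear (T_bounded i)).
by have [Q hQ] := choice aux; exists Q.
Qed.

Variable Q : 'I_n -> {linear H -> H}.
Hypothesis QE : forall i x, Q i x = adjoint (T i) x.

(** [Q_j Q_i] is the adjoint of [T_i T_j], which vanishes when [A i j] is false. *)
Lemma adjoint_rel i j (x : H) : ~~ A i j -> Q j (Q i x) = 0.
Proof.
move=> Aij; apply: hdot_eqr => u; rewrite !QE -!adjointP// T_rel (negPf Aij).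
by rewrite scale0r hdot0l hdot0r.
Qed.

Lemma adjoint_contr (x : H) : 0 <= '[x, x] - \sum_i '[Q i x, Q i x].
Proof.
have := T_contr x; rewrite hdotBl hdot_suml /=; congr (0 <= _ - _).
by apply: eq_bigr => i _; rewrite adjointP// QE.
Qed.

End AdjointTuple.

Section Existence.
Variables (R : realType) (n : nat) (A : 'M[bool]_n) (H : hilbertType R).
Variable Q : 'I_n -> {linear H -> H}.
Hypothesis Q_rel : forall i j (x : H), ~~ A i j -> Q j (Q i x) = 0.
Hypothesis Q_contr : forall x : H, 0 <= '[x, x] - \sum_i '[Q i x, Q i x].

Let b := word_form A Q_contr.
Let K : hilbertType R := completion_hilbert b.

Let create_annihilate i u v : b (create i u) v = b u (annihilate i v).
Proof. exact: (create_adj Q_contr). Qed.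

Let annihilate_create_adj i u v : b (annihilate i u) v = b u (create i v).
Proof. by rewrite sformC -create_annihilate -sformC. Qed.

(** The operators enter through their action on functionals, which is all that
    [lifted_exists] provides. *)
Variables (S B : 'I_n -> {linear K -> K}) (J : {linear H -> K}).
Hypothesis SE : forall i f w, ev (S i f) w = ev f (annihilate i w).
Hypothesis BE : forall i f w, ev (B i f) w = ev f (create i w).
Hypothesis JE : forall h, J h = embed b (trajectory Q_rel h).

Let K_hdot (f g : K) : '[f, g] = pairing f g. Proof. by []. Qed.

Let ev_sum (I : Type) (r : seq I) (F : I -> K) w :
  ev (\sum_(i <- r) F i) w = \sum_(i <- r) ev (F i) w.
Proof. exact: (big_morph (fun f : K => ev f w)). Qed.

Lemma lifted_create_le i f : `|S i f| <= `|f|.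
Proof. by apply: lifted_norm (SE i) _ => v; exact: annihilate_contr. Qed.

Lemma lifted_create_bounded i : bounded_op (S i).
Proof. by exists 1 => f; rewrite mul1r; exact: lifted_create_le. Qed.

Lemma adjoint_lifted_create i f : adjoint (S i) f = B i f.
Proof.
apply: adjoint_eq => g; rewrite !K_hdot.
apply: (lifted_pairing (create_annihilate i) _ _ (SE i) (BE i)) => v.
  exact: create_contr.
exact: annihilate_contr.
Qed.

Lemma lifted_create_embed i v : S i (embed b v) = embed b (create i v).
Proof. exact: (lifted_embed (create_annihilate i) (SE i)). Qed.

Lemma lifted_annihilate_embed i v : B i (embed b v) = embed b (annihilate i v).
Proof. exact: (lifted_embed (annihilate_create_adj i) (BE i)). Qed.

Lemma trajectory_isometry g h : '[J g, J h] = '[g, h].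
Proof. by rewrite !JE K_hdot pairing_embed; exact: word_dot_trajectory. Qed.

Lemma lifted_create_dilation (T : 'I_n -> {linear H -> H}) :
  (forall i h, adjoint (T i) h = Q i h) -> dilation J T S.
Proof.
move=> TQ; split; [exact: trajectory_isometry|exact: lifted_create_bounded|move=> i h].
by rewrite adjoint_lifted_create JE lifted_annihilate_embed annihilate_trajectory TQ -JE.
Qed.

Lemma lifted_create_A_relations : A_relations A S.
Proof.
move=> i j f; apply: completion_eq => w; rewrite evZ !SE.
case Aij : (A i j); first by rewrite mul1r.
have -> : annihilate j (annihilate i w) = 0.
  apply: word_space_eq => s; apply: (word_space_out w (s := i :: j :: s)).
  by rewrite /admissible /= Aij.
by rewrite mul0r -(subrr 0) evB subrr.
Qed.

Lemma lifted_create_cuntz_krieger : cuntz_krieger A S.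
Proof.
have ck i f : adjoint (S i) (S i f) =
    f - \sum_(j < n) (1 - (A i j)%:R) *: S j (adjoint (S j) f).
  rewrite adjoint_lifted_create; apply: completion_eq => w.
  rewrite BE SE annihilate_create evB.
  rewrite -[RHS]/(ev f w - ev (\sum_(j < n) (1 - (A i j)%:R) *: S j (adjoint (S j) f)) w).
  congr (_ - _); rewrite ev_sum.
  have ev_add u v : ev f (u + v) = ev f u + ev f v.
    by rewrite -[u]scale1r ev_antilinear rmorph1 mul1r scale1r.
  have ev0 : ev f 0 = 0 by rewrite -(subrr 0) evB subrr.
  rewrite (big_morph (ev f) ev_add ev0); apply: eq_bigr => j _.
  rewrite evZ SE adjoint_lifted_create BE.
  rewrite -[_ *: create j _]addr0 ev_antilinear ev0 addr0; congr (_ * _).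
  by rewrite rmorphB rmorph1/= conjC_nat.
split=> //; [|move=> i j ij f g|exact: lifted_create_A_relations].
  move=> i.
  exact: (ck_partial_isometry lifted_create_bounded lifted_create_A_relations ck).
rewrite adjointP; last exact: lifted_create_bounded.
rewrite adjoint_lifted_create (_ : B i (S j g) = 0) ?hdot0r//.
apply: completion_eq => w; rewrite BE SE annihilate_create_neq 1?eq_sym//.
by rewrite -(subrr 0) evB subrr.
Qed.

(** Density of an additive set stable under the operators [S i] has to be checked on
    the image of [J] only.  Both the linear span of words and the countable set that
    gives separability are of this kind. *)
Lemma dense_of_closed (F : set K) :
  (forall x y, F x -> F y -> F (x + y)) ->
  (forall i x, F x -> F (S i x)) ->
  (forall h (e : R[i]), 0 < e -> exists2 y, F y & `|J h - y| < e) ->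
  closure F = setT.
Proof.
move=> FD FS FJ.
have Fu u : forall e : R[i], 0 < e -> exists2 y, F y & `|embed b u - y| < e.
  apply: (@word_space_ind _ _ A _ Q Q_rel (fun u => forall e : R[i], 0 < e ->
      exists2 y, F y & `|embed b u - y| < e)) => [v w hv hw|h|i v hv] e e0.
  - have e2 : 0 < e / 2 by rewrite divr_gt0.
    have [x Fx vx] := hv _ e2; have [y Fy wy] := hw _ e2.
    exists (x + y); first exact: FD.
    rewrite linearD opprD addrACA (splitr e); apply: le_lt_trans (ler_normD _ _) _.
    exact: ltrD.
  - by rewrite -JE; exact: FJ.
  - have [x Fx vx] := hv _ e0; exists (S i x); first exact: FS.
    rewrite -lifted_create_embed -[_ - _](linearB (S i)).
    exact: le_lt_trans (lifted_create_le _ _) vx.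
apply/closure_setTP => f e e0; have e2 : 0 < e / 2 by rewrite divr_gt0.
have [v fv] := completion_dense f e2; have [y Fy vy] := Fu v _ e2.
exists y => //; rewrite -[f - y](subrKA (embed b v)) (splitr e).
by apply: le_lt_trans (ler_normD _ _) _; rewrite ler_ltD.
Qed.

Lemma lifted_create_minimal : minimal J S.
Proof.
apply: dense_of_closed => [x y|i x|h e e0].
- move=> [m [c [v [hv ->]]]] [m' [c' [v' [hv' ->]]]].
  exists (m + m')%N,
    (fun k : 'I_(m + m') => match fintype.split k with inl a => c a | inr a => c' a end),
    (fun k : 'I_(m + m') => match fintype.split k with inl a => v a | inr a => v' a end).
  split=> [k|]; first by case: (fintype.split k).
  rewrite big_split_ord/=; congr (_ + _); apply: eq_bigr => k _.
    by rewrite -[lshift _ k]/(unsplit (inl k)) unsplitK.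
  by rewrite -[rshift _ k]/(unsplit (inr k)) unsplitK.
- move=> [m [c [v [hv ->]]]]; exists m, c, (fun k => S i (v k)); split=> [k|].
    by have [a [h ->]] := hv k; exists (i :: a), h.
  by rewrite linear_sum; apply: eq_bigr => k _; rewrite linearZ.
- exists (J h); last by rewrite subrr normr0.
  exists 1%N, (fun=> 1), (fun=> J h); split=> [_|]; first by exists [::], h.
  by rewrite big_ord1 scale1r.
Qed.

Lemma lifted_create_separable : separable H -> separable K.
Proof.
move=> [D Dc Dd].
have [g gD] : exists g : nat -> H, D `<=` range g.
  have /countable_injP[c c_inj] := Dc.
  exists (fun k => xget 0 [set d | D d /\ c d = k]) => d Dd'; exists (c d) => //.
  have [|Dx cx] := xgetPex (0 : H) (_ : exists d', [set d' | D d' /\ c d' = c d] d').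
    by exists d.
  by apply: c_inj; rewrite ?inE.
(* Finite sums of words applied to points of a countable dense set: scalars are
   absorbed into the vectors. *)
pose comb (s : seq (seq 'I_n * nat)) : K := \sum_(p <- s) word S p.1 (J (g p.2)).
exists (range comb); first exact: (sub_countable (card_image_le _ _) (countableP _)).
have closed_comb : closure (range comb) = setT.
  apply: dense_of_closed => [x y|i x|h e e0].
  - by move=> [s _ <-] [t _ <-]; exists (s ++ t) => //; rewrite /comb big_cat.
  - move=> [s _ <-]; exists [seq (i :: p.1, p.2) | p <- s] => //.
    by rewrite /comb big_map linear_sum.
  - have hball : ball h e `&` D !=set0.
      by apply: Dd; [exists h; exact: ballxx|exact: ball_open].
    have [d [hd /gD[k _ kd]]] := hball.
    exists (comb [:: ([::], k)]); first by exists [:: ([::], k)].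
    rewrite /comb big_seq1 /= kd -linearB; rewrite -ball_normE/= in hd.
    suff -> : `|J (h - d)| = `|h - d| by [].
    by apply/eqP; rewrite -(@eqrXn2 _ 2)// !normr_hdot trajectory_isometry.
move=> O [x Ox] Oo.
have : closure (range comb) x by rewrite closed_comb.
move=> /(_ O); case; first exact: open_nbhs_nbhs.
by move=> y [Cy Oy]; exists y.
Qed.

End Existence.

Lemma dilation_exists (R : realType) (n : nat) (A : 'M[bool]_n) (H : hilbertType R)
    (T : 'I_n -> {linear H -> H}) :
  separable H -> (forall i, bounded_op (T i)) -> contractive T -> A_relations A T ->
  exists (K : hilbertType R) (J : {linear H -> K}) (S : 'I_n -> {linear K -> K}),
    separable K /\ minimal_CK_dilation A J T S.
Proof.
move=> Hsep Tb Tc Tr; have [Q QE] := adjoint_linear_exists Tb.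
have Qc := adjoint_contr Tb Tc QE; have Qr := adjoint_rel Tb Tr QE.
pose b := word_form A Qc.
have adj i u v : b (create i u) v = b u (annihilate i v) by exact: (create_adj Qc).
have cc i u : snorm b (create i u) <= snorm b u by exact: create_contr.
have ac i u : snorm b (annihilate i u) <= snorm b u by exact: annihilate_contr.
have adj' i u v : b (annihilate i u) v = b u (create i v).
  by rewrite sformC -adj -sformC.
have [S SE] := choice (fun i => lifted_exists (adj i) (ac i)).
have [B BE] := choice (fun i => lifted_exists (adj' i) (cc i)).
have Jl : linear (fun h => embed b (trajectory Qr h)) by move=> a g h; rewrite !linearP.
have [J JE] := linear_exists Jl.
exists (completion_hilbert b), J, S; split.
  exact: (lifted_create_separable SE JE).
split.
- by apply: (lifted_create_dilation SE BE JE) => i h; rewrite QE.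
- exact: (lifted_create_minimal SE JE).
- exact: (lifted_create_cuntz_krieger SE BE).
Qed.

Theorem theorem11 (R : realType) (n : nat) (A : 'M[bool]_n)
    (A_row : forall i, exists j, A i j) (A_col : forall j, exists i, A i j)
    (H : hilbertType R) (H_sep : separable H)
    (T : 'I_n -> {linear H -> H}) (T_bounded : forall i, bounded_op (T i))
    (T_contr : contractive T) (T_rel : A_relations A T) :
  [/\ exists (K : hilbertType R) (J : {linear H -> K})
        (S : 'I_n -> {linear K -> K}),
        separable K /\ minimal_CK_dilation A J T S,
      forall (K1 K2 : hilbertType R)
        (J1 : {linear H -> K1}) (S1 : 'I_n -> {linear K1 -> K1})
        (J2 : {linear H -> K2}) (S2 : 'I_n -> {linear K2 -> K2}),
        separable K1 -> separable K2 ->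
        minimal_CK_dilation A J1 T S1 -> minimal_CK_dilation A J2 T S2 ->
        dilation_equiv J1 S1 J2 S2
    & forall (K : hilbertType R) (J : {linear H -> K})
        (S : 'I_n -> {linear K -> K}),
        separable K -> minimal_CK_dilation A J T S ->
        (unital S <-> unital T)].
Proof.
split.
- exact: dilation_exists.
- move=> K1 K2 J1 S1 J2 S2 _ _; exact: dilation_unique.
- move=> K J S _ [JTS Smin SCK]; exact: unital_dilation JTS SCK Smin.
Qed.
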